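(* Let $n\ge 3$, let $K=\mathbb{C}(x_1,\ldots,x_n)$, and let $$\Omega=\sum_{i=1}^n P_i\,dx_1\wedge\cdots\wedge\widehat{dx_i}\wedge\cdots\wedge dx_n,\qquad P_i\in K,$$ be an $(n-1)$-form over $K$. If there exists a Liouvillian first integral of $\Omega$, then there exist a finite algebraic extension $\widetilde K$ of $K$ and 1-forms $\omega,\alpha\in\widetilde K'$ with $\omega\neq 0$ such that $$\omega\wedge\Omega=0,\qquad d\omega=\alpha\wedge\omega,\qquad d\alpha=0.$$
   Context: $K=\mathbb{C}(x_1,\ldots,x_n)$ is a differential field with the commuting derivations $\partial/\partial x_1,\ldots,\partial/\partial x_n$. A differential extension of $K$ is an extension field $L$ with commuting derivations extending those of $K$ (again written $\partial/\partial x_i$); derivations extend uniquely to algebraic extensions. The constants $C_L$ are the elements of $L$ annihilated by all the derivations. $L'$ denotes the space of 1-forms $\sum a_i\,dx_i$ with $a_i\in L$ (the $dx_i$ are formal basis elements; forms of higher degree are defined likewise), with the usual wedge product and exterior derivative $d$; for $\phi\in L$, $d\phi=\sum_i(\partial\phi/\partial x_i)\,dx_i$. The hat means that the factor is omitted. A differential extension $L\supset K$ is a Liouvillian extension if $C_L=C_K$ and there is a tower of differential fields $K=K_0\subset K_1\subset\cdots\subset K_m=L$ such that for each $i$ one of the following holds: (i) $K_{i+1}=K_i(t_i)$ with $t_i\ne0$ and $dt_i=\delta_i t_i$ for some $\delta_i\in K_i'$; (ii) $K_{i+1}=K_i(t_i)$ with $dt_i=\delta_i$ for some $\delta_i\in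 K_i'$; (iii) $K_{i+1}$ is a finite algebraic extension of $K_i$. A Liouvillian first integral of $\Omega$ is a non-constant element $\phi$ of some Liouvillian extension of $K$ with $d\phi\wedge\Omega=0$. *)

(* Defs.v *)
From HB Require Import structures.
From mathcomp Require Import all_boot all_algebra.
From mathcomp Require Import boolp classical_sets reals.
From mathcomp Require Import complex mpoly ring.
Set Implicit Arguments.
Unset Strict Implicit.
Unset Printing Implicit Defensive.

Import GRing.Theory.
Local Open Scope ring_scope.

Definition commuting_derivations (n : nat) (L : fieldType)
    (D : 'I_n -> L -> L) : Prop :=
  [/\ forall i x y, D i (x + y) = D i x + D i y,
      forall i x y, D i (x * y) = D i x * y + x * D i y
    & forall i j x, D i (D j x) = D j (D i x)].

Definition constants (n : nat) (L : fieldType) (D : 'I_n -> L -> L) : set L :=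
  [set x | forall i, D i x = 0]%classic.

Definition differential_extension (n : nat) (K : fieldType)
    (DK : 'I_n -> K -> K) (L : fieldType) (DL : 'I_n -> L -> L)
    (iota : {rmorphism K -> L}) : Prop :=
  commuting_derivations DL /\ forall i f, DL i (iota f) = iota (DK i f).

Notation ratfun R n := {fraction {mpoly R[i][n]}}.

(* The quotient rule, applied to a chosen numerator and denominator; by
   [frac_derE] the choice does not matter when [d] is a derivation. *)
Definition frac_der (A : idomainType) (d : A -> A) (f : {fraction A}) :
    {fraction A} :=
  let p := (\n_(repr f)) in let q := (\d_(repr f)) in
  tofrac (d p * q - p * d q) / tofrac q ^+ 2.

Definition pderiv (R : realType) (n : nat) (i : 'I_n) :
    ratfun R n -> ratfun R n :=
  frac_der (@mderiv n R[i] i).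

Lemma quotient_rule_add (F : fieldType) (p q r s dp dq dr ds : F) :
  q != 0 -> s != 0 ->
  ((dp * s + p * ds + (dr * q + r * dq)) * (q * s) -
     (p * s + r * q) * (dq * s + q * ds)) / (q * s) ^+ 2 =
  (dp * q - p * dq) / q ^+ 2 + (dr * s - r * ds) / s ^+ 2.
Proof. by move=> q0 s0; field; rewrite q0 s0. Qed.

Lemma quotient_rule_mul (F : fieldType) (p q r s dp dq dr ds : F) :
  q != 0 -> s != 0 ->
  ((dp * r + p * dr) * (q * s) - (p * r) * (dq * s + q * ds)) / (q * s) ^+ 2 =
  (dp * q - p * dq) / q ^+ 2 * (r / s) + p / q * ((dr * s - r * ds) / s ^+ 2).
Proof. by move=> q0 s0; field; rewrite q0 s0. Qed.

Section FractionDerivation.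
Variable A : idomainType.
Implicit Types (p q : A) (x y f : {fraction A}).

Lemma frac_numden f : f = tofrac (\n_(repr f)) / tofrac (\d_(repr f)).
Proof.
rewrite -[LHS]reprK; case: (repr f) => [[p q] /= q0].
have qF0 : tofrac q != 0 by rewrite tofrac_eq0.
apply: (mulIf qF0); rewrite divfK //.
rewrite !piE; apply/eqmodP; rewrite /= FracField.equivfE /FracField.mulf /=.
by rewrite !numden_Ratio ?oner_neq0 ?mulr1 ?mulf_neq0 // ?mulr1 mulrC.
Qed.

Lemma fracP f : exists p q, q != 0 /\ f = tofrac p / tofrac q.
Proof.
by exists (\n_(repr f)), (\d_(repr f)); split;
  [apply: denom_ratioP | apply: frac_numden].
Qed.

Variable d : A -> A.
Hypothesis dD : forall p q, d (p + q) = d p + d q.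
Hypothesis dM : forall p q, d (p * q) = d p * q + p * d q.

Lemma frac_derE p q : q != 0 ->
  frac_der d (tofrac p / tofrac q) =
  tofrac (d p * q - p * d q) / tofrac q ^+ 2.
Proof.
move=> q0; rewrite /frac_der; set f := tofrac p / tofrac q.
set p1 := (\n_(repr f)); set q1 := (\d_(repr f)).
have q10 : q1 != 0 by apply: denom_ratioP.
have qF0 : tofrac q != 0 by rewrite tofrac_eq0.
have q1F0 : tofrac q1 != 0 by rewrite tofrac_eq0.
have fE : f = tofrac p1 / tofrac q1 by apply: frac_numden.
have E : p1 * q = p * q1.
  apply/eqP; rewrite -tofrac_eq !tofracM; apply/eqP.
  by move: fE; rewrite /f => /eqP; rewrite eqr_div // => /eqP.
have dE : d p1 * q + p1 * d q = d p * q1 + p * d q1 by rewrite -!dM E.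
apply/eqP; rewrite eqr_div ?expf_neq0 // -!tofracXn -!tofracM tofrac_eq.
apply/eqP; move: dE E; move: (d p1) (d q1) (d p) (d q).
clearbody p1 q1 => dp1 dq1 dp dq dE E.
have -> : (dp1 * q1 - p1 * dq1) * q ^+ 2 =
  (dp1 * q + p1 * dq) * q * q1 - (p1 * q) * (dq * q1 + q * dq1) by ring.
by rewrite dE E; ring.
Qed.

Lemma frac_derD x y : frac_der d (x + y) = frac_der d x + frac_der d y.
Proof.
have [p [q [q0 ->]]] := fracP x; have [r [s [s0 ->]]] := fracP y.
have qF0 : tofrac q != 0 by rewrite tofrac_eq0.
have sF0 : tofrac s != 0 by rewrite tofrac_eq0.
rewrite addf_div // -!tofracM -tofracD !frac_derE ?mulf_neq0 //.
rewrite !(dD, dM) !(tofracD, tofracN, tofracM).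
exact: quotient_rule_add.
Qed.

Lemma frac_derM x y : frac_der d (x * y) = frac_der d x * y + x * frac_der d y.
Proof.
have [p [q [q0 ->]]] := fracP x; have [r [s [s0 ->]]] := fracP y.
have qF0 : tofrac q != 0 by rewrite tofrac_eq0.
have sF0 : tofrac s != 0 by rewrite tofrac_eq0.
rewrite mulf_div -!tofracM !frac_derE ?mulf_neq0 //.
rewrite !(dD, dM) !(tofracD, tofracN, tofracM).
exact: quotient_rule_mul.
Qed.

Lemma frac_der_tofrac p : frac_der d (tofrac p) = tofrac (d p).
Proof.
have d1 : d 1 = 0.
  by apply: (addIr (d 1)); rewrite add0r -{3}(mulr1 1) dM mulr1 mul1r.
rewrite -[tofrac p]divr1 -tofrac1 frac_derE ?oner_neq0 //.
by rewrite d1 mulr0 subr0 mulr1 tofrac1 expr1n divr1.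
Qed.

End FractionDerivation.

Lemma frac_der_comm (A : idomainType) (d e : A -> A) :
  (forall p q, d (p + q) = d p + d q) ->
  (forall p q, d (p * q) = d p * q + p * d q) ->
  (forall p q, e (p + q) = e p + e q) ->
  (forall p q, e (p * q) = e p * q + p * e q) ->
  (forall p, d (e p) = e (d p)) ->
  forall f, frac_der d (frac_der e f) = frac_der e (frac_der d f).
Proof.
move=> dD dM eD eM dC f; have [p [q [q0 ->]]] := fracP f.
have key (g h : A -> A) :
    (forall p q, g (p + q) = g p + g q) ->
    (forall p q, g (p * q) = g p * q + p * g q) ->
    (forall p q, h (p * q) = h p * q + p * h q) ->
  frac_der g (frac_der h (tofrac p / tofrac q)) =
  tofrac ((g (h p) * q + h p * g q - (g p * h q + p * g (h q))) * (q * q)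
    - (h p * q - p * h q) * (g q * q + q * g q)) / tofrac (q * q) ^+ 2.
  move=> gD gM hM; rewrite (frac_derE hM) // -tofracXn expr2.
  rewrite (frac_derE gM) ?mulf_neq0 // -!gM; congr (tofrac (_ * _ - _) / _).
  by apply: (addIr (g (p * h q))); rewrite -gD !subrK.
rewrite !key //; congr (tofrac _ / _); rewrite (dC p) (dC q).
by move: (e (d p)) (e (d q)) (d p) (d q) (e p) (e q) => *; ring.
Qed.

Lemma pderiv_commuting (R : realType) (n : nat) :
  commuting_derivations (@pderiv R n).
Proof.
split=> [i x y|i x y|i j x].
- by apply: frac_derD; [apply: mderivD | apply: mderivM].
- by apply: frac_derM; apply: mderivM.
- apply: frac_der_comm; [exact: mderivD|exact: mderivM|exact: mderivD
    |exact: mderivM|exact: mderiv_comm].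
Qed.

Lemma pderivX (R : realType) (n : nat) (i j : 'I_n) :
  pderiv i (tofrac 'X_j : ratfun R n) = (i == j)%:R.
Proof.
rewrite /pderiv frac_der_tofrac; last exact: mderivM.
rewrite mderivX mnm1E eq_sym; case: eqVneq => [->|_].
  have -> : (U_(j) - U_(j))%MM = 0%MM by rewrite -{1}[U_(j)%MM]add0m addmK.
  by rewrite mpolyX0 scale1r tofrac1.
by rewrite scale0r tofrac0.
Qed.

Lemma pderivC (R : realType) (n : nat) (i : 'I_n) (c : R[i]) :
  pderiv i (tofrac c%:MP : ratfun R n) = 0.
Proof.
by rewrite /pderiv frac_der_tofrac ?mderivC ?tofrac0 //; apply: mderivM.
Qed.

(* [w S] is the coefficient in [w] of dx_{s_1} /\ ... /\ dx_{s_p}, where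
   S = {s_1 < ... < s_p}; forms of all degrees live in the same type. *)
Definition dform (n : nat) (L : fieldType) := {ffun {set 'I_n} -> L^o}.

Section Forms.
Variables (n : nat) (L : fieldType).
Implicit Types u v w : dform n L.

Definition homogeneous (p : nat) w : Prop :=
  forall S : {set 'I_n}, #|S| != p -> w S = 0.

Definition form0 (a : L) : dform n L :=
  [ffun S : {set 'I_n} => if #|S| == 0%N then a else 0].

Definition dx (i : 'I_n) : dform n L :=
  [ffun S : {set 'I_n} => (S == [set i]%SET)%:R].

(* Number of transpositions needed to sort the concatenation of the increasing
   enumerations of A and B. *)
Definition inversions (A B : {set 'I_n}) : nat :=
  #|[set ij : 'I_n * 'I_n | [&& ij.1 \in A, ij.2 \in B & (ij.2 < ij.1)%N]]%SET|.

Definition wedge u v : dform n L :=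
  [ffun S : {set 'I_n} => \sum_(A : {set 'I_n} | A \subset S)
     (-1) ^+ inversions A (S :\: A) * (u A * v (S :\: A))].

Definition extd (D : 'I_n -> L -> L) w : dform n L :=
  \sum_(i < n) wedge (dx i) [ffun S : {set 'I_n} => D i (w S)].

(* Sum of P_i dx_1 /\ ... /\ dx_n with dx_i omitted. *)
Definition codim1_form (P : 'I_n -> L) : dform n L :=
  \sum_(i < n) P i *: \big[wedge/form0 1]_(j < n | j != i) dx j.

End Forms.

Definition map_form (n : nat) (K L : fieldType) (iota : K -> L)
    (w : dform n K) : dform n L :=
  [ffun S : {set 'I_n} => iota (w S)].

Section Liouville.
Variables (n : nat) (L : fieldType) (D : 'I_n -> L -> L).
Local Open Scope classical_set_scope.
Implicit Types A B : set L.

Definition is_subfield A : Prop :=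
  [/\ A 1, forall x y, A x -> A y -> A (x - y)
    & forall x y, A x -> A y -> A (x / y)].

Definition is_diff_subfield A : Prop :=
  is_subfield A /\ forall i x, A x -> A (D i x).

Definition adjoin A (t : L) : set L := smallest is_subfield (A `|` [set t]).

Definition one_form_over A (delta : dform n L) : Prop :=
  homogeneous 1 delta /\ forall S, A (delta S).

Definition finite_over A B : Prop :=
  exists (m : nat) (b : 'I_m -> L), (forall k, B (b k)) /\
    forall x, B x -> exists2 c : 'I_m -> L,
      (forall k, A (c k)) & x = \sum_(k < m) c k * b k.

Definition liouvillian_step A B : Prop :=
  [\/ exists t : L, [/\ B = adjoin A t, t != 0 & exists2 delta : dform n L,
        one_form_over A delta & extd D (form0 n t) = t *: delta],
      exists t : L, B = adjoin A t /\ exists2 delta : dform n L,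
        one_form_over A delta & extd D (form0 n t) = delta
    | finite_over A B].

Definition liouvillian_tower A : Prop :=
  exists (m : nat) (F : nat -> set L),
    [/\ F 0%N = A, F m = setT,
        forall i, (i <= m)%N -> is_diff_subfield (F i)
      & forall i, (i < m)%N ->
          F i `<=` F i.+1 /\ liouvillian_step (F i) (F i.+1)].

End Liouville.

Definition liouvillian_extension (n : nat) (K : fieldType)
    (DK : 'I_n -> K -> K) (L : fieldType) (DL : 'I_n -> L -> L)
    (iota : {rmorphism K -> L}) : Prop :=
  [/\ differential_extension DK DL iota,
      constants DL = (iota @` constants DK)%classic
    & liouvillian_tower DL (range iota)].

Definition has_liouvillian_first_integral (n : nat) (K : fieldType)
    (DK : 'I_n -> K -> K) (Omega : dform n K) : Prop :=
  exists (L : fieldType) (DL : 'I_n -> L -> L) (iota : {rmorphism K -> L}),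
    liouvillian_extension DK DL iota /\
    exists phi : L, ~ constants DL phi /\
      wedge (extd DL (form0 n phi)) (map_form iota Omega) = 0.

(* Main.v *)
(* Proof idea.  Call a pair (w, a) of 1-forms with w <> 0, w /\ Omega = 0,
   dw = a /\ w and da = 0 good.  In the top field of the tower, (d phi, 0) is
   good, and a good pair over an algebraic extension of K_(i+1) yields one over
   an algebraic extension of K_i.  Only a step K_(i+1) = K_i(t) with t
   transcendental is not immediate.  After replacing t by 1/t in the case
   dt = delta, one has dt = beta t + gamma t^2 with d beta = 0.  By
   Newton-Puiseux the coefficients of w and a embed in the field of Laurent
   series in u over an algebraic extension k of K_i, where u^q = t; the
   derivations become D u = eta u with eta a power series, so they respect the
   u-adic filtration, and d eta(0) = 0.  Let w_0 and a_0 be the leading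
   coefficients of w = w_0 u^r + ... and a = a_0 u^v + ....  If v >= 0 then
   dw_0 = (a_(0) - r eta(0)) /\ w_0 with a_(0) the constant coefficient of a,
   which is closed; if v < 0 then a_0 /\ w_0 = 0, so a_0 is proportional to w_0
   and kills Omega, while da = 0 gives da_0 = - v eta(0) /\ a_0.  Either way
   there is a good pair over k. *)
From HB Require Import structures.
Require Import Defs.
From mathcomp Require Import all_boot all_algebra all_field.
From mathcomp Require Import boolp classical_sets reals.
From mathcomp Require Import complex mpoly ring.
Import GRing.Theory.
Local Open Scope ring_scope.
Set Implicit Arguments.
Unset Strict Implicit.
Unset Printing Implicit Defensive.

(** * Ring morphisms, algebraic elements and minimal polynomials *)

Lemma rmorphism_of_rel (A B : nzRingType) (Rl : A -> B -> Prop) :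
  (forall x, exists y, Rl x y) -> Rl 1 1 ->
  (forall x y x' y', Rl x x' -> Rl y y' -> Rl (x - y) (x' - y')) ->
  (forall x y x' y', Rl x x' -> Rl y y' -> Rl (x * y) (x' * y')) ->
  (forall y, Rl 0 y -> y = 0) ->
  exists f : {rmorphism A -> B}, forall x, Rl x (f x).
Proof.
move=> tot R1 RB RM R0; have [f fP] := boolp.choice tot.
(* Two values at [x] differ by a value at 0, so the relation is a function. *)
have Rfun x y y' : Rl x y -> Rl x y' -> y = y'.
  move=> xy xy'; apply/eqP; rewrite -subr_eq0; apply/eqP/R0.
  by rewrite -(subrr x); apply: RB.
have fB : zmod_morphism f.
  by move=> x y; apply: Rfun (fP _) _; apply: RB.
have fM : monoid_morphism f.
  by split=> [|x y]; apply: Rfun (fP _) _ => //; apply: RM.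
pose zM := GRing.isZmodMorphism.Build A B f fB.
pose mM := GRing.isMonoidMorphism.Build A B f fM.
pose g : {rmorphism A -> B} := HB.pack f zM mM.
by exists g.
Qed.

(** [A] is the fraction field of the image of [sigma], and equal kernels make the quotients of
    values of [rho] well defined. It serves for N(s), with [P] a polynomial ring, and for quotients
    of polynomial rings. *)
Lemma rmorphism_of_fractions (P : nzRingType) (A B : fieldType)
    (sigma : {rmorphism P -> A}) (rho : {rmorphism P -> B}) :
  (forall p, sigma p = 0 <-> rho p = 0) ->
  (forall x, exists a b, sigma b != 0 /\ x = sigma a / sigma b) ->
  exists theta : {rmorphism A -> B}, forall p, theta (sigma p) = rho p.
Proof.
move=> ker_eq frac.
have nz p : (rho p != 0) = (sigma p != 0).
  by apply/idP/idP; apply: contraNneq => /ker_eq ->.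
pose Rl (x : A) (y : B) :=
  exists a b, [/\ sigma b != 0, x = sigma a / sigma b & y = rho a / rho b].
have R0 y : Rl 0 y -> y = 0.
  case=> a [b [b0 /esym/eqP]]; rewrite mulf_eq0 invr_eq0 (negPf b0) orbF.
  by move=> /eqP/ker_eq -> ->; rewrite mul0r.
have RB x y x' y' : Rl x x' -> Rl y y' -> Rl (x - y) (x' - y').
  move=> [a [b [b0 -> ->]]] [c [d [d0 -> ->]]].
  exists (a * d - c * b), (b * d); rewrite rmorphM mulf_neq0 //; split=> //.
    by rewrite -mulNr addf_div // rmorphB !rmorphM /= mulNr.
  rewrite -mulNr addf_div ?nz // rmorphB !rmorphM /= mulNr.
  by [].
have [|||f fP] := @rmorphism_of_rel A B Rl _ _ RB _ R0.
- by move=> x; have [a [b [b0 ->]]] := frac x; exists (rho a / rho b), a, b.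
- by exists 1, 1; rewrite !rmorph1 !divr1 oner_neq0.
- move=> x y x' y' [a [b [b0 -> ->]]] [c [d [d0 -> ->]]].
  exists (a * c), (b * d); rewrite rmorphM mulf_neq0 //; split=> //.
    by rewrite mulf_div !rmorphM.
  by rewrite mulf_div !rmorphM.
exists f => p; have [a [b [b0 e e']]] := fP (sigma p).
rewrite e' (_ : rho a = rho p * rho b) ?mulfK ?nz // -rmorphM.
apply/eqP; rewrite -subr_eq0 -rmorphB; apply/eqP/ker_eq.
by rewrite rmorphB rmorphM e divfK // subrr.
Qed.

(** Over a field algebraic means integral, and a root of a monic polynomial with integral
    coefficients is integral. *)
Lemma algebraicOver_trans (F S E : fieldType) (i : {rmorphism F -> S})
    (j : {rmorphism S -> E}) x :
  (forall y, algebraicOver i y) -> algebraicOver j x ->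
  algebraicOver (j \o i) x.
Proof.
move=> algS /integral_algebraic[p p_mon px].
apply/(integral_algebraic (j \o i)).
apply: (integral_root_monic (p := map_poly j p)) => //.
  exact: monic_map.
apply/integral_poly => k; rewrite coef_map.
by apply: integral_rmorph; apply/integral_algebraic.
Qed.

Lemma algebraicOver_sub (F S E : fieldType) (i : {rmorphism F -> S})
    (j : {rmorphism S -> E}) y :
  algebraicOver (j \o i) (j y) -> algebraicOver i y.
Proof.
case=> p p0 r; exists p => //; move: r.
by rewrite map_poly_comp /= /root horner_map fmorph_eq0.
Qed.

Lemma algebraicOver_horner (F E : fieldType) (i : {rmorphism F -> E})
    (q : {poly F}) z :
  algebraicOver i z -> algebraicOver i (map_poly i q).[z].
Proof.
move=> algz; apply/integral_algebraic/integral_horner.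
  by apply/integral_poly => k; rewrite coef_map; apply: integral_id.
exact/integral_algebraic.
Qed.

Section MinimalPolynomial.
Variables (F E : fieldType) (i : {rmorphism F -> E}) (x : E).

Lemma minimal_polynomial : [pchar F] =i pred0 -> algebraicOver i x ->
  exists p : {poly F},
    [/\ irreducible_poly p, root (map_poly i p) x,
        (map_poly i p^`()).[x] != 0
      & forall q, root (map_poly i q) x -> p %| q].
Proof.
move=> char0 [p0 p0_neq0 p0x].
pose Pn m :=
  `[< exists p : {poly F}, [/\ p != 0, root (map_poly i p) x & size p = m] >].
have exP : exists m, Pn m by exists (size p0); apply/asboolP; exists p0.
case: (ex_minnP exP) => m /asboolP[p [p_neq0 px sz]] minm.
have min q : root (map_poly i q) x -> q != 0 -> (size p <= size q)%N.
  by move=> qx q0; rewrite sz; apply: minm; apply/asboolP; exists q.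
have dvd q : root (map_poly i q) x -> p %| q.
  move=> qx; apply/modp_eq0P/eqP; apply: contraT => r0.
  have : (size p <= size (q %% p)%R)%N.
    apply: min => //; move: qx; rewrite {1}(divp_eq q p) rmorphD rmorphM /=.
    by rewrite /root hornerD hornerM (rootP px) mulr0 add0r.
  by rewrite leqNgt ltn_modp p_neq0.
have irr : irreducible_poly p by apply/(subfx_irreducibleP px p_neq0).
(* If the derivative of [p] vanished at [x], minimality would make it 0, against its top coefficient
   in characteristic 0. *)
exists p; split => //; apply/eqP => /rootP p'x.
have p_gt1 : (1 < size p)%N by case: irr.
have := min _ p'x; rewrite leqNgt lt_size_deriv // => H.
suff : p^`() != 0 by move/H.
have [l szE] : exists l, size p = l.+2.
  by case: (size p) p_gt1 => [|[|l]] // _; exists l.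
apply/eqP => /polyP/(_ l); rewrite coef_deriv coef0 => /eqP.
rewrite -mulr_natr mulf_eq0 ((pcharf0P F).1 char0) orbF.
have -> : l.+1 = (size p).-1 by rewrite szE.
by rewrite -/(lead_coef p) lead_coef_eq0 (negPf p_neq0).
Qed.

End MinimalPolynomial.

Lemma pchar0_rmorph (F E : fieldType) (i : {rmorphism F -> E}) :
  [pchar F] =i pred0 -> [pchar E] =i pred0.
Proof. by move=> char0 p; rewrite (fmorph_pchar i). Qed.

(** * Derivations and their extension to algebraic extensions *)

Section Derivations.

(** Applying [d] to p(x) = 0, with p the minimal polynomial, gives p'(x) d(x) = 0, and p'(x) is not
    0. The twist by [s] lets [d] be a difference of two derivations read in a larger field. *)
Lemma twisted_derivation_eq0 (F S E : fieldType) (i : {rmorphism F -> S})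
    (s : {rmorphism S -> E}) (d : S -> E) x :
  [pchar F] =i pred0 ->
  (forall y z, d (y + z) = d y + d z) ->
  (forall y z, d (y * z) = d y * s z + s y * d z) ->
  (forall c, d (i c) = 0) -> algebraicOver i x -> d x = 0.
Proof.
move=> char0 dD dM di /(minimal_polynomial char0)[p [_ px p'x _]].
have key (q : {poly F}) :
    d ((map_poly i q).[x]) = s ((map_poly i q^`()).[x]) * d x.
  elim/poly_ind: q => [|q c IH].
    by rewrite deriv0 !map_poly0 !horner0 rmorph0 mul0r -(rmorph0 i) di.
  rewrite derivMXaddC !rmorphD !rmorphM /= !map_polyX !map_polyC /=.
  rewrite !hornerMXaddC hornerD hornerMX dD di addr0 dM IH.
  by rewrite rmorphD rmorphM mulrDl addrC mulrAC.
have := key p; rewrite (rootP px).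
have -> : d 0 = 0 by rewrite -(rmorph0 i) di.
move/esym/eqP; rewrite mulf_eq0 fmorph_eq0 (negPf p'x) /=.
by move/eqP.
Qed.

Variables (F : fieldType) (D : F -> F).
Hypothesis DD : forall x y, D (x + y) = D x + D y.
Hypothesis DM : forall x y, D (x * y) = D x * y + x * D y.

Lemma derivation0 : D 0 = 0.
Proof. by apply: (addIr (D 0)); rewrite -DD !add0r. Qed.

Lemma derivation1 : D 1 = 0.
Proof. by apply: (addIr (D 1)); rewrite add0r -{3}(mulr1 1) DM mulr1 mul1r. Qed.

Lemma derivationN x : D (- x) = - D x.
Proof. by apply/eqP; rewrite -addr_eq0 -DD addNr derivation0. Qed.

Lemma derivationB x y : D (x - y) = D x - D y.
Proof. by rewrite DD derivationN. Qed.

Lemma derivationMn x m : D (x *+ m) = D x *+ m.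
Proof.
by elim: m => [|m IH]; rewrite ?mulr0n ?derivation0 // !mulrS DD IH.
Qed.

Lemma derivation_nat m : D m%:R = 0.
Proof. by rewrite derivationMn derivation1 mul0rn. Qed.

Lemma derivation_sum I (r : seq I) (P : pred I) (f : I -> F) :
  D (\sum_(k <- r | P k) f k) = \sum_(k <- r | P k) D (f k).
Proof. by apply: (big_morph D DD derivation0). Qed.

Lemma derivationV x : D x^-1 = - D x / x ^+ 2.
Proof.
have [->|x0] := eqVneq x 0; first by rewrite invr0 derivation0 oppr0 mul0r.
apply: (mulfI x0); have := derivation1; rewrite -(mulfV x0) DM.
move/eqP; rewrite addrC addr_eq0 => /eqP ->.
by field.
Qed.

Lemma map_poly_derivation (p q : {poly F}) :
  map_poly D (p * q) = map_poly D p * q + p * map_poly D q.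
Proof.
apply/polyP => k; rewrite coef_map_id0 ?derivation0 // coefD !coefM.
rewrite derivation_sum -big_split; apply: eq_bigr => l _.
by rewrite DM !coef_map_id0 ?derivation0.
Qed.

Lemma map_poly_derivationD (p q : {poly F}) :
  map_poly D (p + q) = map_poly D p + map_poly D q.
Proof.
by apply/polyP => k; rewrite !(coef_map_id0, coefD) ?derivation0.
Qed.

(** Differentiating p(z) = 0 forces the derivative of z to be [h]. Then [T q] is the derivative of
    q(z), and it depends on q(z) only because [T] kills the multiples of [p]. *)
Lemma derivation_simple_ext (S : fieldType) (i : {rmorphism F -> S}) (z : S) :
  [pchar F] =i pred0 -> algebraicOver i z ->
  (forall x, exists q, x = (map_poly i q).[z]) ->
  exists D' : S -> S, [/\ forall x y, D' (x + y) = D' x + D' y,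
    forall x y, D' (x * y) = D' x * y + x * D' y
    & forall c, D' (i c) = i (D c)].
Proof.
move=> char0 /(minimal_polynomial char0)[p [_ pz p'z p_dvd]] gen.
pose h := - (map_poly i (map_poly D p)).[z] / (map_poly i p^`()).[z].
pose T q := (map_poly i (map_poly D q)).[z] + (map_poly i q^`()).[z] * h.
pose ev q := (map_poly i q).[z].
have evD q r : ev (q + r) = ev q + ev r by rewrite /ev rmorphD hornerD.
have evM q r : ev (q * r) = ev q * ev r by rewrite /ev rmorphM hornerM.
have TD q r : T (q + r) = T q + T r.
  rewrite /T map_poly_derivationD derivD !rmorphD /= !hornerD mulrDl.
  by rewrite addrACA.
have TM q r : T (q * r) = T q * ev r + ev q * T r.
  rewrite /T /ev map_poly_derivation derivM !rmorphD !rmorphM /= !hornerD.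
  by rewrite !hornerM; ring.
have Tp : T p = 0.
  by rewrite /T /h mulrC divfK // addrN.
have T0 q : ev q = 0 -> T q = 0.
  move/rootP/p_dvd/dvdpP => [r ->]; rewrite TM Tp mulr0 addr0.
  by rewrite /ev (rootP pz) mulr0.
have TN q : T (- q) = - T q.
  by apply/eqP; rewrite -addr_eq0 -TD addNr T0 // /ev rmorph0 horner0.
have [f fP0] := boolp.choice gen.
have fP x : x = ev (f x) by exact: fP0.
have Teq q r : ev q = ev r -> T q = T r.
  move=> e; apply/eqP; rewrite -subr_eq0 -TN -TD; apply/eqP/T0.
  by rewrite evD e /ev rmorphN hornerN subrr.
exists (fun x => T (f x)); split.
- by move=> x y; rewrite -TD; apply: Teq; rewrite -fP evD -!fP.
- move=> x y; rewrite (_ : _ + _ = T (f x * f y)); last by rewrite TM -!fP.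
  by apply: Teq; rewrite -fP evM -!fP.
- move=> c; rewrite (_ : T _ = T c%:P); last first.
    by apply: Teq; rewrite -fP /ev map_polyC hornerC.
  rewrite /T derivC map_poly0 horner0 mul0r addr0.
  have -> : map_poly D c%:P = (D c)%:P.
    apply/polyP => k; rewrite coef_map_id0 ?derivation0 // !coefC.
    by case: eqP => // _; rewrite derivation0.
  by rewrite map_polyC hornerC.
Qed.

End Derivations.

(** * Differential fields of characteristic 0 *)

Record dfield (n : nat) := DField {
  dsort :> fieldType;
  der : 'I_n -> dsort -> dsort;
  dpchar0 : [pchar dsort] =i pred0;
  derP : commuting_derivations der }.

Section DField.
Variables (n : nat).
Implicit Types A B C : dfield n.

Lemma derD A i (x y : A) : der i (x + y) = der i x + der i y.
Proof. by case: (derP A). Qed.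
Lemma derM A i (x y : A) : der i (x * y) = der i x * y + x * der i y.
Proof. by case: (derP A). Qed.
Lemma derC A i j (x : A) : der i (der j x) = der j (der i x).
Proof. by case: (derP A). Qed.

Definition dmorph A B (h : A -> B) := forall i x, der i (h x) = h (der i x).

Definition dalg A B (h : {rmorphism A -> B}) :=
  dmorph h /\ forall y, algebraicOver h y.

Lemma dalg_comp A B C (h : {rmorphism A -> B}) (g : {rmorphism B -> C}) :
  dalg h -> dalg g -> dalg (g \o h).
Proof.
move=> [dh ah] [dg ag]; split=> [i x /=|y]; first by rewrite dg dh.
exact: algebraicOver_trans.
Qed.

Lemma dalg_id A : dalg (idfun : {rmorphism A -> A}).
Proof. by split=> // y; apply: (algebraic_id idfun). Qed.

Lemma dfield_simple_ext A (S : fieldType) (i : {rmorphism A -> S}) (z : S) :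
  algebraicOver i z -> (forall x, exists q, x = (map_poly i q).[z]) ->
  exists D : 'I_n -> S -> S, commuting_derivations D /\
    forall k c, D k (i c) = i (der k c).
Proof.
move=> algz gen.
have algS x : algebraicOver i x.
  by have [q ->] := gen x; apply: algebraicOver_horner.
have /boolp.choice[D DP] := fun k => derivation_simple_ext
  (@derD A k) (@derM A k) (@dpchar0 _ A) algz gen.
have DD k : forall x y, D k (x + y) = D k x + D k y by case: (DP k).
have DM k : forall x y, D k (x * y) = D k x * y + x * D k y by case: (DP k).
have DE k c : D k (i c) = i (der k c) by case: (DP k).
exists D; split=> //; split=> // k l x.
(* The commutator of two derivations is a derivation, and it vanishes on [A]. *)
apply/eqP; rewrite -subr_eq0; apply/eqP.
pose d x := D k (D l x) - D l (D k x); rewrite -/(d x).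
apply: (@twisted_derivation_eq0 _ _ _ i idfun d x (@dpchar0 _ A)) => //.
- by move=> y y'; rewrite /d !DD; ring.
- by move=> y y' /=; rewrite /d !(DM, DD); ring.
- by move=> c; rewrite /d !DE derC subrr.
Qed.

End DField.

(** * The ring of formal power series in a variable u *)

Definition pser (k : fieldType) : Type := nat -> k.

Section PowerSeries.
Variable k : fieldType.
Implicit Types (f g h : pser k).

HB.instance Definition _ := gen_eqMixin (pser k).
HB.instance Definition _ := gen_choiceMixin (pser k).

Definition ps_add f g : pser k := fun m => f m + g m.
Definition ps_opp f : pser k := fun m => - f m.
Definition ps_zero : pser k := fun=> 0.

Lemma ps_addA : associative ps_add.
Proof. by move=> f g h; apply/funext => m; apply: addrA. Qed.
Lemma ps_addC : commutative ps_add.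
Proof. by move=> f g; apply/funext => m; apply: addrC. Qed.
Lemma ps_add0 : left_id ps_zero ps_add.
Proof. by move=> f; apply/funext => m; apply: add0r. Qed.
Lemma ps_addN : left_inverse ps_zero ps_opp ps_add.
Proof. by move=> f; apply/funext => m; apply: addNr. Qed.

HB.instance Definition _ :=
  GRing.isZmodule.Build (pser k) ps_addA ps_addC ps_add0 ps_addN.

Definition ps_mul f g : pser k := fun m => \sum_(i < m.+1) f i * g (m - i)%N.
Definition ps_one : pser k := fun m => (m == 0%N)%:R.

(** Congruence with a polynomial modulo u^m. Associativity and commutativity of the product are read
    off from truncations, where they hold for polynomials. *)
Definition psapprox m f (p : {poly k}) := forall i, (i < m)%N -> f i = p`_i.

Definition pstrunc m f : {poly k} := \poly_(i < m) f i.

Lemma pstruncP m f : psapprox m f (pstrunc m f).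
Proof. by move=> i im; rewrite coef_poly im. Qed.

Lemma psapprox_mul m f g p q :
  psapprox m f p -> psapprox m g q -> psapprox m (ps_mul f g) (p * q).
Proof.
move=> fp gq i im; rewrite coefM; apply: eq_bigr => j _.
by rewrite fp ?gq //; apply: leq_ltn_trans im; rewrite ?leq_subr // -ltnS.
Qed.

Lemma ps_mulA : associative ps_mul.
Proof.
move=> f g h; apply/funext => m; have T := @pstruncP m.+1.
rewrite (psapprox_mul (T f) (psapprox_mul (T g) (T h)) (ltnSn m)).
by rewrite (psapprox_mul (psapprox_mul (T f) (T g)) (T h) (ltnSn m)) mulrA.
Qed.

Lemma ps_mulC : commutative ps_mul.
Proof.
move=> f g; apply/funext => m; have T := @pstruncP m.+1.
by rewrite (psapprox_mul (T f) (T g)) // (psapprox_mul (T g) (T f)) // mulrC.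
Qed.

Lemma ps_mul1 : left_id ps_one ps_mul.
Proof.
move=> f; apply/funext => m; rewrite /ps_mul big_ord_recl /= subn0 mul1r.
by rewrite big1 ?addr0 // => i _; rewrite /ps_one /= mul0r.
Qed.

Lemma ps_mulD : left_distributive ps_mul ps_add.
Proof.
move=> f g h; apply/funext => m; rewrite /ps_mul /ps_add -big_split.
by apply: eq_bigr => i _; rewrite mulrDl.
Qed.

Lemma ps_one_neq0 : ps_one != ps_zero.
Proof.
by apply/eqP => /(congr1 (fun f => f 0%N))/eqP; rewrite /ps_one oner_eq0.
Qed.

HB.instance Definition _ := GRing.Zmodule_isComNzRing.Build (pser k)
  ps_mulA ps_mulC ps_mul1 ps_mulD ps_one_neq0.

Lemma ps1E i : (1 : pser k) i = (i == 0%N)%:R. Proof. by []. Qed.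
Lemma psDE f g i : (f + g) i = f i + g i. Proof. by []. Qed.
Lemma psNE f i : (- f) i = - f i. Proof. by []. Qed.
Lemma psME f g i : (f * g) i = \sum_(j < i.+1) f j * g (i - j)%N.
Proof. by []. Qed.

Lemma psMn f m i : (f *+ m) i = f i *+ m.
Proof. by elim: m => [|m IH] //; rewrite !mulrS -IH. Qed.

Lemma ps_neq0 f : f != 0 ->
  exists v, f v != 0 /\ forall i, (i < v)%N -> f i = 0.
Proof.
move=> f0; have exv : exists v, f v != 0.
  apply: contrapT => /forallNP nof; move/eqP: f0; apply; apply/funext => i.
  by apply/eqP/negPn/negP/nof.
case: (ex_minnP exv) => v fv minv; exists v; split=> // i iv.
by apply/eqP; apply: contraLR iv => /minv; rewrite leqNgt.
Qed.

(** At the sum of the two orders, the coefficient of the product is the product of the lowest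
    coefficients. *)
Lemma ps_mulf_eq0 f g : f * g = 0 -> (f == 0) || (g == 0).
Proof.
move=> fg0; apply/norP => -[/ps_neq0[v [fv vmin]] /ps_neq0[w [gw wmin]]].
have : (f * g) (v + w)%N = f v * g w.
  rewrite [LHS](bigD1 (Ordinal (leq_addr w v : v < (v + w).+1)%N)) //=.
  rewrite addKn big1 ?addr0 // => i; rewrite -val_eqE /= => iv.
  have [lt_iv|le_vi] := ltnP i v; first by rewrite vmin ?mul0r.
  have lt_vi : (v < i)%N by rewrite ltn_neqAle eq_sym iv.
  rewrite wmin ?mulr0 // ltn_subLR ?ltn_add2r //.
  by rewrite -ltnS.
by rewrite fg0 => /esym/eqP; rewrite mulf_eq0 (negPf fv) (negPf gw).
Qed.

(** Invertibility by mere existence, the inverse by choice; [ps_unitE] identifies the units by their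
    constant term. *)
Definition ps_unit : {pred pser k} := fun f => `[< exists g, g * f = 1 >].
Definition ps_inv f : pser k :=
  if pselect (exists g, g * f = 1) is left e then projT1 (cid e) else f.

Lemma ps_mulV : {in ps_unit, left_inverse 1 ps_inv *%R}.
Proof.
by move=> f /asboolP e; rewrite /ps_inv; case: pselect => // e'; case: cid.
Qed.

Lemma ps_unitP f g : g * f = 1 -> ps_unit f.
Proof. by move=> e; apply/asboolP; exists g. Qed.

Lemma ps_inv_out : {in [predC ps_unit], ps_inv =1 id}.
Proof. by move=> f /asboolPn e; rewrite /ps_inv; case: pselect. Qed.

HB.instance Definition _ := GRing.ComNzRing_hasMulInverse.Build (pser k)
  ps_mulV ps_unitP ps_inv_out.
HB.instance Definition _ :=
  GRing.ComUnitRing_isIntegral.Build (pser k) ps_mulf_eq0.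

Definition ps0 f : k := f 0%N.

Lemma ps0_zmod : zmod_morphism ps0. Proof. by []. Qed.
Lemma ps0_monoid : monoid_morphism ps0.
Proof. by split=> // f g; rewrite /ps0 [LHS]big_ord1. Qed.
HB.instance Definition _ := GRing.isZmodMorphism.Build _ _ ps0 ps0_zmod.
HB.instance Definition _ := GRing.isMonoidMorphism.Build _ _ ps0 ps0_monoid.

Definition pspoly (p : {poly k}) : pser k := fun i => p`_i.

Lemma pspoly_zmod : zmod_morphism pspoly.
Proof. by move=> p q; apply/funext => i; rewrite /pspoly coefB. Qed.
Lemma pspoly_monoid : monoid_morphism pspoly.
Proof.
split=> [|p q]; apply/funext => i; rewrite /pspoly; first by rewrite coef1.
by rewrite coefM.
Qed.
HB.instance Definition _ := GRing.isZmodMorphism.Build _ _ pspoly pspoly_zmod.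
HB.instance Definition _ :=
  GRing.isMonoidMorphism.Build _ _ pspoly pspoly_monoid.

Lemma pspoly_eq0 p : (pspoly p == 0) = (p == 0).
Proof.
apply/eqP/eqP => [p0|->]; last exact: rmorph0.
by apply/polyP => i; rewrite coef0 -[LHS]/(pspoly p i) p0.
Qed.

Definition psC c : pser k := pspoly c%:P.
HB.instance Definition _ := GRing.RMorphism.copy psC (pspoly \o polyC).

Definition psXn m : pser k := pspoly 'X^m.

Lemma psXnE m i : psXn m i = (i == m)%:R.
Proof. by rewrite /psXn /pspoly coefXn. Qed.

Lemma psXnD m l : psXn (m + l) = psXn m * psXn l.
Proof. by rewrite /psXn exprD rmorphM. Qed.

Lemma psXn0 : psXn 0 = 1.
Proof. by rewrite /psXn expr0 rmorph1. Qed.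

Lemma psXn_neq0 m : psXn m != 0.
Proof. by rewrite pspoly_eq0 monic_neq0 ?monicXn. Qed.

Lemma psXnM m f i : (psXn m * f) i = if (i < m)%N then 0 else f (i - m)%N.
Proof.
have T := @pstruncP i.+1 f.
rewrite [LHS](psapprox_mul (p := 'X^m) (fun _ _ => erefl) T) //.
by rewrite coefXnM coef_poly ltnS leq_subr.
Qed.

Lemma psC0 c : psC c 0%N = c.
Proof. by rewrite /psC /pspoly coefC. Qed.

Definition psdvd m f := forall i, (i < m)%N -> f i = 0.
Definition psshift m f : pser k := fun i => f (i + m)%N.

Lemma psdvdP m f : psdvd m f <-> f = psXn m * psshift m f.
Proof.
split=> [fm|-> i im]; last by rewrite psXnM im.
apply/funext => i; rewrite psXnM; case: ltnP => [/fm//|mi].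
by rewrite /psshift subnK.
Qed.

Lemma psdvd_Xn m f : psdvd m (psXn m * f).
Proof. by move=> i im; rewrite psXnM im. Qed.

Lemma psdvdM a b f g : psdvd a f -> psdvd b g -> psdvd (a + b) (f * g).
Proof.
move=> /psdvdP -> /psdvdP ->; rewrite mulrACA -psXnD; exact: psdvd_Xn.
Qed.

Lemma psdvdD a f g : psdvd a f -> psdvd a g -> psdvd a (f + g).
Proof. by move=> fa ga i ia; rewrite psDE fa // ga // addr0. Qed.

Lemma psdvdN a f : psdvd a f -> psdvd a (- f).
Proof. by move=> fa i ia; rewrite psNE fa // oppr0. Qed.

Lemma psdvd1 f : psdvd 1 f <-> ps0 f = 0.
Proof. by split=> [f1|f0 [|//]] //; apply: f1. Qed.

Lemma psdvd1B f g : ps0 f = ps0 g -> psdvd 1 (f - g).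
Proof. by move=> fg; apply/psdvd1; rewrite rmorphB /= fg subrr. Qed.

Lemma psdvdMr a f g : psdvd a f -> psdvd a (f * g).
Proof. by move=> fa; rewrite -[a]addn0; apply: psdvdM => // i. Qed.


Lemma ps0_horner (F : {poly pser k}) x : ps0 F.[x] = (map_poly ps0 F).[ps0 x].
Proof. by rewrite horner_map. Qed.

(** Hensel's lemma, by Newton iteration with the constant slope [a]: each step gains one power of u,
    so every coefficient becomes stationary. *)
Lemma ps_simple_root (F : {poly pser k}) :
  ps0 F`_0 = 0 -> ps0 F`_1 != 0 -> exists h, ps0 h = 0 /\ F.[h] = 0.
Proof.
move=> F0 F1; set a := ps0 F`_1.
have F0x x : ps0 x = 0 -> ps0 F.[x] = 0.
  by move=> x0; rewrite ps0_horner x0 horner_coef0 coef_map.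
(* For x and y without constant term the difference quotient of [F] is congruent to [a] modulo u. *)
have diff x y : ps0 x = 0 -> ps0 y = 0 ->
    exists Q, F.[x] - F.[y] = Q * (x - y) /\ ps0 Q = a.
  move=> x0 y0; have : root (F - F.[y]%:P) y.
    by rewrite /root hornerD hornerN hornerC subrr.
  case/factor_theorem => q qE; exists q.[x]; split.
    by move/(congr1 (horner^~ x)): qE; rewrite !hornerE.
  rewrite ps0_horner x0 horner_coef0 coef_map.
  have := congr1 (fun p => (map_poly ps0 p)`_1) qE.
  rewrite rmorphM rmorphB /= map_polyXsubC /= y0 subr0 coefMX /= coefB.
  by rewrite !coef_map /= coefC /= subr0 => <-.
pose step x := x - psC a^-1 * F.[x].
have step0 x : ps0 x = 0 -> ps0 (step x) = 0.
  by move=> x0; rewrite rmorphB rmorphM /= x0 F0x // mulr0 subr0.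
have contr m x y : ps0 x = 0 -> ps0 y = 0 -> psdvd m (x - y) ->
    psdvd m.+1 (step x - step y).
  move=> x0 y0 xy; have [Q [QE Q0]] := diff x y x0 y0.
  have -> : step x - step y = (1 - psC a^-1 * Q) * (x - y).
    by rewrite mulrBl mul1r -mulrA -QE /step; ring.
  rewrite -add1n; apply: psdvdM => //; apply/psdvd1.
  by rewrite rmorphB rmorphM /= rmorph1 Q0 /ps0 psC0 mulVf ?subrr.
pose x_ m := iter m step 0.
have x0 m : ps0 (x_ m) = 0.
  by elim: m => [|m IH] /=; [apply: rmorph0 | apply: step0].
have xS m : psdvd m.+1 (x_ m.+1 - x_ m).
  elim: m => [|m IH]; last by apply: contr IH; apply: x0.
  by apply: psdvd1B; rewrite !x0.
have xE m i : (i <= m)%N -> x_ m i = x_ i i.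
  elim: m => [|m IH]; first by rewrite leqn0 => /eqP ->.
  rewrite leq_eqVlt => /predU1P[->//|im]; rewrite -IH // -[LHS](subrK (x_ m i)).
  by rewrite (xS m i im : x_ m.+1 i - x_ m i = 0) add0r.
(* The limit: coefficient [i] no longer changes from the [i]-th iterate on. *)
pose h : pser k := fun i => x_ i i.
have h0 : ps0 h = 0 by [].
exists h; split=> //; apply/funext => m.
suff : psdvd m.+1 F.[h] by apply.
have [Q [QE _]] := diff h (x_ m) h0 (x0 m).
rewrite -[F.[h]](subrK F.[x_ m]) QE; apply: psdvdD.
  rewrite mulrC; apply: psdvdMr => i im.
  by rewrite psDE psNE xE // subrr.
(* The value of [F] at an iterate is [-a] times the next increment, so it is divisible by
   u^(m+1). *)
have -> : F.[x_ m] = - (x_ m.+1 - x_ m) * psC a.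
  rewrite /= /step opprB subKr mulrAC -rmorphM mulVf //.
  by rewrite rmorph1 mul1r.
exact/psdvdMr/psdvdN/xS.
Qed.

Lemma ps_unitE f : (f \is a GRing.unit) = (ps0 f != 0).
Proof.
apply/idP/idP => [fU|f0].
  by rewrite -unitfE; apply: rmorph_unit.
(* A root [h] of f (Y + 1/c) - 1 without constant term makes h + 1/c the inverse of [f]. *)
pose c := ps0 f; pose F : {poly pser k} := f *: 'X + (f * psC c^-1 - 1)%:P.
have [||h [_]] := @ps_simple_root F.
- rewrite coefD coefZ coefX mulr0 add0r coefC /= rmorphB rmorphM rmorph1 /=.
  by rewrite /ps0 psC0 mulfV ?subrr.
- by rewrite coefD coefZ coefX mulr1 coefC addr0.
- rewrite !hornerE => E; apply/unitrP; exists (h + psC c^-1).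
  have E' : f * (h + psC c^-1) = 1.
    by apply/eqP; rewrite -subr_eq0 mulrDr; apply/eqP.
  by rewrite mulrC E'.
Qed.

Section Derivation.
Variables (D : k -> k) (eta : pser k).
Hypothesis DD : forall x y, D (x + y) = D x + D y.
Hypothesis DM : forall x y, D (x * y) = D x * y + x * D y.

Definition pscoef f : pser k := fun m => D (f m).
(** The Euler operator u d/du. *)
Definition pseuler f : pser k := fun m => f m *+ m.

(* The derivation extending [D] with [u |-> eta * u], [u] the variable. *)
Definition psder f : pser k := locked (pscoef f + eta * pseuler f).

Lemma psderE f : psder f = pscoef f + eta * pseuler f.
Proof. by rewrite /psder -lock. Qed.

Lemma psderD f g : psder (f + g) = psder f + psder g.
Proof.
rewrite !psderE addrACA -mulrDr; congr (_ + eta * _).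
  by apply/funext => m; apply: DD.
by apply/funext => m; apply: mulrnDl.
Qed.

Lemma pscoefM f g : pscoef (f * g) = pscoef f * g + f * pscoef g.
Proof.
apply/funext => m; rewrite psDE !psME /pscoef psME derivation_sum // -big_split.
by apply: eq_bigr => i _; rewrite DM.
Qed.

Lemma pseulerM f g : pseuler (f * g) = pseuler f * g + f * pseuler g.
Proof.
apply/funext => m; rewrite psDE !psME /pseuler psME -sumrMnl -big_split.
apply: eq_bigr => i _ /=; rewrite mulrnAl mulrnAr -mulrnDr subnKC //.
by rewrite -ltnS.
Qed.

Lemma psderM f g : psder (f * g) = psder f * g + f * psder g.
Proof. by rewrite !psderE pscoefM pseulerM; ring. Qed.

(** The Euler operator kills the constant term. This lets differential identities between series be
    read on constant coefficients. *)
Lemma ps0_psder f : ps0 (psder f) = D (ps0 f).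
Proof.
have e0 : ps0 (pseuler f) = 0 by rewrite /ps0 /pseuler mulr0n.
by rewrite !psderE rmorphD rmorphM /= e0 mulr0 addr0.
Qed.

Lemma psderC c : psder (psC c) = psC (D c).
Proof.
have -> : psder (psC c) = pscoef (psC c).
  rewrite !psderE (_ : pseuler _ = 0) ?mulr0 ?addr0 //.
  apply/funext => m; rewrite /pseuler /psC /pspoly coefC.
  by case: m => [|m] /=; rewrite ?mulr0n ?mul0rn.
apply/funext => m; rewrite /pscoef /psC /pspoly !coefC.
by case: eqP => // _; rewrite derivation0.
Qed.

Lemma psderXn m : psder (psXn m) = eta * psXn m *+ m.
Proof.
rewrite !psderE (_ : pscoef _ = 0) ?add0r.
  rewrite -mulrnAr; congr (_ * _); apply/funext => i.
  by rewrite /pseuler psMn psXnE; case: eqP => [->//|]; rewrite !mul0rn.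
apply/funext => i; rewrite /pscoef psXnE; case: eqP => _.
  exact: derivation1.
exact: derivation0.
Qed.

End Derivation.

End PowerSeries.

(** * Change of coefficients together with u |-> u^q *)

Section PowerSeriesMap.
Variables (k l : fieldType) (h : {rmorphism k -> l}) (q : nat).

(* [u |-> u ^ q] on the variable, [h] on the coefficients; [q = 0] is junk. *)
Definition psmap (f : pser k) : pser l :=
  fun m => if (q.-1.+1 %| m)%N then h (f (m %/ q.-1.+1)%N) else 0.

(** On truncations the map is composition with a power of X, which gives multiplicativity. *)
Lemma psmap_approx m f p :
  psapprox m f p -> psapprox m (psmap f) (map_poly h p \Po 'X^(q.-1.+1)).
Proof.
move=> fp i im; rewrite coef_comp_poly_Xn // /psmap; case: ifP => // _.
by rewrite coef_map fp // (leq_ltn_trans (leq_div _ _)).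
Qed.

Lemma psmap_zmod : zmod_morphism psmap.
Proof.
move=> f g; apply/funext => m; rewrite psDE psNE /psmap.
by case: ifP; rewrite ?subr0 // -rmorphB.
Qed.

Lemma psmap_monoid : monoid_morphism psmap.
Proof.
split=> [|f g]; apply/funext => m.
  rewrite /psmap !ps1E; case: ifP => [/dvdnP[c ->]|].
    by rewrite mulnK // rmorph_nat muln_eq0 orbF.
  by case: m.
have T f1 := @pstruncP k m.+1 f1.
rewrite [LHS](psmap_approx (psapprox_mul (T f) (T g)) (ltnSn m)).
rewrite [RHS](psapprox_mul (psmap_approx (T f)) (psmap_approx (T g)) (ltnSn m)).
by rewrite rmorphM comp_polyM.
Qed.

HB.instance Definition _ := GRing.isZmodMorphism.Build _ _ psmap psmap_zmod.
HB.instance Definition _ := GRing.isMonoidMorphism.Build _ _ psmap psmap_monoid.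

Lemma psmap_inj f : (psmap f == 0) = (f == 0).
Proof.
apply/eqP/eqP => [f0|->]; last exact: rmorph0.
apply/funext => m; have := congr1 (fun g => g (m * q.-1.+1)%N) f0.
by rewrite /psmap dvdn_mull // mulnK // => /eqP; rewrite fmorph_eq0 => /eqP.
Qed.

Lemma psmap_C c : psmap (psC c) = psC (h c).
Proof.
apply/funext => m; rewrite /psmap /psC /pspoly /= !coefC.
case: m => [|m]; first by rewrite dvdn0 div0n.
case: ifP => [d|] //; rewrite -leqn0 leqNgt divn_gt0 // dvdn_leq //.
exact: rmorph0.
Qed.

Lemma psmap_Xn m : (0 < q)%N -> psmap (psXn k m) = psXn l (q * m).
Proof.
move=> q0; apply/funext => i; rewrite /psmap !psXnE prednK //.
case: ifP => [/dvdnP[c ->]|].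
  by rewrite mulnK // rmorph_nat mulnC eqn_pmul2l.
by case: eqP => // ->; rewrite dvdn_mulr.
Qed.

End PowerSeriesMap.

Lemma psmap_id (k : fieldType) (f : pser k) : psmap idfun 1 f = f.
Proof. by apply/funext => m; rewrite /psmap dvd1n divn1. Qed.

Lemma psmap_comp (k l r : fieldType) (h : {rmorphism k -> l})
    (g : {rmorphism l -> r}) p q f : (0 < p)%N -> (0 < q)%N ->
  psmap g q (psmap h p f) = psmap (g \o h) (q * p) f.
Proof.
move=> p0 q0; apply/funext => m; rewrite /psmap /= !prednK ?muln_gt0 ?p0 ?q0 //.
have [/dvdnP[c ->]|nd] := boolP (q %| m)%N; last first.
  rewrite ifF //; apply: contraNF nd; apply: dvdn_trans; exact: dvdn_mulr.
rewrite mulnK // [(c * q)%N]mulnC dvdn_pmul2l // divnMl //.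
by case: ifP; rewrite ?rmorph0.
Qed.

(** * The Newton-Puiseux theorem over a differential field of coefficients *)

Lemma irreducible_factor (F : fieldType) (p : {poly F}) :
  (1 < size p)%N -> exists r, irreducible_poly r /\ r %| p.
Proof.
move=> p_gt1; have p0 : p != 0 by rewrite -size_poly_gt0 (ltn_trans _ p_gt1).
pose Pn m :=
  `[< exists r : {poly F}, [/\ (1 < size r)%N, r %| p & size r = m] >].
have exP : exists m, Pn m.
  by exists (size p); apply/asboolP; exists p; rewrite dvdpp.
(* A divisor of least size above 1 is irreducible. *)
case: (ex_minnP exP) => m /asboolP[r [r_gt1 rp sz]] minm.
exists r; split=> //; split=> // q q_neq1 qr; rewrite -dvdp_size_eqp //.
have r0 : r != 0 by rewrite -size_poly_gt0 (ltn_trans _ r_gt1).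
rewrite eqn_leq dvdp_leq //= sz; apply: minm; apply/asboolP.
exists q; split=> //; last exact: dvdp_trans rp.
rewrite ltn_neqAle eq_sym q_neq1 size_poly_gt0.
by apply: contraNneq r0 => q0; rewrite q0 dvd0p in qr.
Qed.

(** Stands in for an algebraic closure: the coefficient field is enlarged one root at a time, and
    the derivations extend because each enlargement is simple. *)
Lemma dfield_adjoin_root n (A : dfield n) (p : {poly A}) : (1 < size p)%N ->
  exists (B : dfield n) (i : {rmorphism A -> B}),
    dalg i /\ exists z, root (map_poly i p) z.
Proof.
case/irreducible_factor => r [irr rp].
have [L _ [z rz gen]] := irredp_FAdjoin irr.
pose i : {rmorphism A -> L} := in_alg L.
have algz : algebraicOver i z by exists r => //; apply: irredp_neq0.
have genz x : exists q, x = (map_poly i q).[z].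
  have : x \in <<1; z>>%VS by rewrite gen memvf.
  by case/Fadjoin1_polyP => q ->; exists q.
have [D [DP DE]] := dfield_simple_ext algz genz.
exists (DField (pchar0_rmorph i (@dpchar0 _ A)) DP), i; split.
  by split=> // x; have [q ->] := genz x; apply: algebraicOver_horner.
exists z; case/dvdpP: rp => s ->.
by rewrite rmorphM rootM [X in _ || X]rz orbT.
Qed.

(** Taylor's formula with the divided derivatives. *)
Lemma coef_comp_XaddC (R : comNzRingType) (p : {poly R}) c i :
  (p \Po ('X + c%:P))`_i = p^`N(i).[c].
Proof.
have -> : p \Po ('X + c%:P) = \poly_(k < size p) p^`N(k).[c].
  rewrite /comp_poly addrC nderiv_taylor; last exact: mulrC.
  rewrite size_map_polyC poly_def; apply: eq_bigr => k _.
  by rewrite nderivn_map horner_map /= mul_polyC.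
rewrite coef_poly; case: ltnP => // le; rewrite nderivn_poly0 ?horner0 //.
Qed.

Section NewtonPuiseux.
Variable n : nat.

(** Induction on [m], the multiplicity of 0 as a root of [f] modulo u: shift away one coefficient,
    rescale along the first edge of the Newton polygon, and move to a root of the edge polynomial,
    whose multiplicity is smaller than [m]. *)
Theorem newton_puiseux m (A : dfield n) (f : {poly pser A}) : (0 < m)%N ->
  (forall i, (i < m)%N -> ps0 f`_i = 0) -> ps0 f`_m != 0 ->
  exists (B : dfield n) (j : {rmorphism A -> B}) (q : nat) (g : pser B),
    [/\ dalg j, (0 < q)%N & root (map_poly (psmap j q) f) g].
Proof.
have [N le_mN] := ubnP m.
elim: N => // N IHN in m le_mN A f *; move=> m_gt0 f_lt f_m.
have charA := (pcharf0P A).1 (@dpchar0 _ A).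
have binm : 'C(m, m.-1) = m by rewrite -{1}(prednK m_gt0) binSn prednK.
(* Modulo u this divided derivative starts with 0 + m f_m Y, so it has a root [h]; the shift by [h]
   kills the coefficient of Y^(m-1). *)
have [||h [h0 hroot]] := @ps_simple_root A f^`N(m.-1).
- by rewrite coef_nderivn addn0 binn f_lt // prednK.
- rewrite coef_nderivn addn1 prednK // binm.
  by rewrite rmorphMn /= -mulr_natr mulf_neq0 // charA -lt0n.
(* Without a term in [Y ^ m.-1], the polynomial [e] of the first edge below has
   no root of multiplicity [m], whence the induction. *)
pose f2 := f \Po ('X + h%:P).
have f2E i : f2`_i = f^`N(i).[h] by apply: coef_comp_XaddC.
have f20 i : ps0 f2`_i = ps0 f`_i.
  rewrite f2E ps0_horner h0 horner_coef0 coef_map /= coef_nderivn.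
  by rewrite addn0 binn.
have f2_m1 : f2`_m.-1 = 0 by rewrite f2E.
have [c0|c0] := eqVneq f2`_0 0.
  exists A, idfun, 1%N, h; split=> //; first exact: dalg_id.
  rewrite (eq_map_poly (g := id)) => [|x]; last exact: psmap_id.
  by rewrite map_poly_id // /root -c0 f2E nderivn0.
have /boolp.choice[v vP] : forall i, exists w, f2`_i != 0 ->
    f2`_i w != 0 /\ psdvd w f2`_i.
  move=> i; have [->|/ps_neq0[w wP]] := eqVneq f2`_i 0; first by exists 0%N.
  by exists w.
(* The first edge of the Newton polygon joins [(i0, v i0)] and [(m, 0)]. *)
have [i0 [i0m ci0 slope]] : exists i0, [/\ (i0 < m)%N, f2`_i0 != 0 &
    forall i, (i < m)%N -> f2`_i != 0 ->
      (v i0 * (m - i) <= v i * (m - i0))%N].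
  (* [w i] is m! times the slope [v i / (m - i)], a natural number since [m - i] divides m!. *)
  pose w (i : 'I_m) := (v i * (m`! %/ (m - i)))%N.
  case: (@arg_minnP _ (Ordinal m_gt0) (fun i : 'I_m => f2`_i != 0) w c0).
  move=> i0 ci0 imin; exists i0; split=> // i im ci.
  have := imin (Ordinal im) ci; rewrite /w /=.
  have d k : (k < m)%N -> (m`! %/ (m - k) * (m - k))%N = m`!.
    by move=> km; rewrite divnK // dvdn_fact // subn_gt0 km leq_subr.
  rewrite -(@leq_pmul2r ((m - i) * (m - i0))) ?muln_gt0 ?subn_gt0 ?im //=.
  have -> : (v i0 * (m`! %/ (m - i0)) * ((m - i) * (m - i0)) =
    v i0 * (m - i) * m`!)%N by rewrite -[in RHS](d i0 (ltn_ord i0)); ring.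
  have -> : (v i * (m`! %/ (m - i)) * ((m - i) * (m - i0)) =
    v i * (m - i0) * m`!)%N by rewrite -[in RHS](d i im); ring.
  by rewrite leq_pmul2r ?fact_gt0.
(* The substitution u |-> u^q, Y = u^p Z makes the edge of slope p/q horizontal: u^(pm) divides the
   result, and [f3] is the quotient. *)
pose q := (m - i0)%N; pose p := v i0.
have q_gt0 : (0 < q)%N by rewrite subn_gt0.
have p_gt0 : (0 < p)%N.
  have [cv _] := vP _ ci0; rewrite lt0n; apply: contraNneq cv => e.
  by rewrite -/p e -[_ == _]/(ps0 f2`_i0 == 0) f20 f_lt.
pose psi : {rmorphism pser A -> pser A} := psmap idfun q.
have psi_dvd i : (i < m)%N -> psdvd (p * (m - i)) (psi f2`_i).
  move=> im l; have [->|ci] := eqVneq f2`_i 0; first by rewrite rmorph0.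
  rewrite /psi /= /psmap prednK //; case: ifP => // /dvdnP[c ->].
  move=> lt; rewrite mulnK //=; have [_ -> //] := vP _ ci.
  by rewrite -(ltn_pmul2r q_gt0); apply: leq_trans lt (slope _ im ci).
pose f3 : {poly pser A} := \poly_(i < size f2)
  if (i < m)%N then psshift (p * (m - i)) (psi f2`_i)
  else psXn A (p * (i - m)) * psi f2`_i.
have f3E i : f3`_i = if (i < m)%N then psshift (p * (m - i)) (psi f2`_i)
    else psXn A (p * (i - m)) * psi f2`_i.
  rewrite coef_poly; case: ltnP => // /(nth_default 0) ->.
  by rewrite rmorph0; case: ifP => // _; rewrite mulr0.
have f3_scale i :
    psi f2`_i * psXn A (p * i) = psXn A (p * m) * f3`_i.
  rewrite f3E; case: ltnP => im.
    have /psdvdP {1}-> := psi_dvd i im; rewrite mulrAC -psXnD -mulnDr.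
    by rewrite subnK // ltnW.
  by rewrite mulrA -psXnD -mulnDr subnKC // mulrC.
have Xexp i : psXn A p ^+ i = psXn A (p * i).
  elim: i => [|i IH]; first by rewrite muln0 psXn0.
  by rewrite exprS IH -psXnD mulnS.
(* This is f2 (u^p Z) = u^(pm) f3 (Z) after [psi], under an arbitrary morphism [phi] because the
   root lives over a further extension. *)
have f3_horner (R : comNzRingType) (phi : {rmorphism pser A -> R}) Z :
    (map_poly phi (map_poly psi f2)).[phi (psXn A p) * Z] =
    phi (psXn A (p * m)) * (map_poly phi f3).[Z].
  rewrite -map_poly_comp !(@horner_coef_wide _ (size f2)) ?size_poly //;
    last exact: leq_trans (size_poly _ _) (size_poly _ _).
  rewrite mulr_sumr; apply: eq_bigr => i _; rewrite !coef_map /=.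
  rewrite exprMn -rmorphXn /= Xexp mulrA -!rmorphM /= f3_scale.
  by rewrite rmorphM mulrA.
(* The edge polynomial: it has degree [m], no term of degree m - 1, and a non-zero term of degree
   [i0 < m]. *)
pose e := map_poly (@ps0 A) f3.
have eE i : e`_i = ps0 f3`_i by rewrite coef_map.
have e_i0 : e`_i0 != 0.
  have [cv _] := vP _ ci0; rewrite eE f3E i0m /ps0 /psshift /psi /= /psmap.
  by rewrite prednK // add0n -/q dvdn_mull // mulnK.
have e_m : e`_m != 0.
  rewrite eE f3E ltnn subnn muln0 psXn0 mul1r /psi /ps0 /= /psmap dvdn0 /=.
  rewrite div0n.
  by rewrite -[_ == _]/(ps0 f2`_m == 0) f20.
have e_m1 : e`_m.-1 = 0.
  by rewrite eE f3E ltn_predL m_gt0 f2_m1 rmorph0.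
have e_gt i : (m < i)%N -> e`_i = 0.
  move=> mi; rewrite eE f3E ltnNge ltnW //= rmorphM /= /ps0 psXnE.
  by rewrite eq_sym muln_eq0 subn_eq0 leqNgt mi orbF gtn_eqF // mul0r.
have size_e : (1 < size e)%N.
  rewrite ltnNge; apply: contra e_m => le.
  by rewrite nth_default // (leq_trans le).
have [B1 [i1 [algi1 [c rc]]]] := dfield_adjoin_root size_e.
have charB := (pcharf0P B1).1 (@dpchar0 _ B1).
pose E := map_poly i1 e \Po ('X + c%:P).
have EE i : E`_i = (map_poly i1 e^`N(i)).[c].
  by rewrite coef_comp_XaddC nderivn_map.
have E_m : E`_m = i1 e`_m.
  rewrite EE (_ : e^`N(m) = (e`_m)%:P) ?map_polyC ?hornerC //.
  apply/polyP => i; rewrite coef_nderivn coefC; case: i => [|i].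
    by rewrite addn0 binn.
  by rewrite e_gt ?mul0rn // -addn1 leq_add2l.
have E_m1 : E`_m.-1 = i1 e`_m * c *+ m.
  rewrite EE (_ : e^`N(m.-1) = (e`_m *+ m) *: 'X).
    by rewrite map_polyZ map_polyX hornerZ hornerX rmorphMn /= mulrnAl.
  apply/polyP => i; rewrite coef_nderivn coefZ coefX.
  case: i => [|[|i]]; first by rewrite addn0 e_m1 mul0rn mulr0.
    by rewrite addn1 prednK // binm mulr1.
  by rewrite e_gt ?mul0rn ?mulr0 // !addnS ltnS -addSn prednK // leq_addr.
have exE : exists k, E`_k != 0 by exists m; rewrite E_m fmorph_eq0.
(* [m'] is the multiplicity of the root [c] of [e]. *)
case: (ex_minnP exE) => m' Em' m'min.
have E_lt i : (i < m')%N -> E`_i = 0.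
  by move=> im'; apply/eqP; apply: contraLR im' => /m'min; rewrite leqNgt.
have m'_gt0 : (0 < m')%N.
  rewrite lt0n; apply: contraNneq Em' => ->.
  by rewrite EE nderivn0; apply: rc.
have m'_ltm : (m' < m)%N.
  (* If [m' = m], the vanishing coefficient of degree m - 1 is m c e_m, so c = 0 and [E] is [e],
     which would then have no term of degree [i0]. *)
  rewrite ltn_neqAle m'min ?E_m ?fmorph_eq0 // andbT; apply/eqP => mm.
  have := E_m1; rewrite E_lt ?mm ?ltn_predL // => /esym/eqP.
  rewrite -mulr_natr !mulf_eq0 fmorph_eq0 (negPf e_m) charB gtn_eqF // orbF /=.
  move/eqP => c_0; have := E_lt i0; rewrite mm i0m => /(_ isT)/eqP.
  by rewrite /E c_0 addr0 comp_polyXr coef_map fmorph_eq0 (negPf e_i0).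
pose psi1 : {rmorphism pser A -> pser B1} := psmap i1 1.
pose f4 := map_poly psi1 f3 \Po ('X + (psC c)%:P).
have f40 i : ps0 f4`_i = E`_i.
  rewrite -[LHS]coef_map map_comp_poly rmorphD /= map_polyX map_polyC /=.
  rewrite [ps0 _]psC0 -map_poly_comp /E -map_poly_comp; congr ((_ \Po _)`_i).
have [|||B [j2 [q2 [g2 [algj2 q2_gt0 rootg2]]]]] := IHN m' _ B1 f4 m'_gt0.
- by apply: leq_trans m'_ltm _; rewrite -ltnS.
- by move=> i /E_lt; rewrite f40.
- by rewrite f40.
pose phi2 : {rmorphism pser B1 -> pser B} := psmap j2 q2.
pose phi : {rmorphism pser A -> pser B} := phi2 \o psi1.
(* The substitutions are undone: Y = u^p (Z + c) + h with Z = [g2], everything mapped to the last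
   extension. *)
exists B, (j2 \o i1), (q2 * q)%N,
  (phi (psXn A p) * (g2 + phi2 (psC c)) + phi (psi h)).
split; [exact: dalg_comp | by rewrite muln_gt0 q2_gt0 |].
have mapE :
    map_poly (psmap (j2 \o i1) (q2 * q)) f = map_poly phi (map_poly psi f).
  rewrite -map_poly_comp; apply: eq_map_poly => x.
  by rewrite /phi /psi /phi2 /psi1 /= !psmap_comp ?muln1 // muln_gt0 q2_gt0.
have f3root : (map_poly phi f3).[g2 + phi2 (psC c)] = 0.
  move/rootP: rootg2; rewrite map_comp_poly rmorphD /= map_polyX map_polyC /=.
  by rewrite horner_comp !hornerE -map_poly_comp.
have := f3_horner _ phi (g2 + phi2 (psC c)); rewrite f3root mulr0.
rewrite /f2 !map_comp_poly !rmorphD /= !map_polyX !map_polyC /=.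
by rewrite horner_comp !hornerE mapE /root => ->.
Qed.

End NewtonPuiseux.

(** After a shift by a root [c] of [f] modulo u the previous theorem applies, with [m] the
    multiplicity of [c]; monicity keeps [f] modulo u non-constant. *)
Lemma newton_puiseux_monic n (A : dfield n) (f : {poly pser A}) :
  f \is monic -> (1 < size f)%N ->
  exists (B : dfield n) (j : {rmorphism A -> B}) (q : nat) (g : pser B),
    [/\ dalg j, (0 < q)%N & root (map_poly (psmap j q) f) g].
Proof.
move=> f_mon f_gt1; pose e := map_poly (@ps0 A) f.
have [|B1 [i1 [algi1 [c rc]]]] := @dfield_adjoin_root _ _ e.
  by rewrite size_map_poly_id0 // (monicP f_mon) /= rmorph1 oner_neq0.
pose psi1 : {rmorphism pser A -> pser B1} := psmap i1 1.
pose f4 := map_poly psi1 f \Po ('X + (psC c)%:P).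
pose E := map_poly i1 e \Po ('X + c%:P).
have f40 i : ps0 f4`_i = E`_i.
  rewrite -[LHS]coef_map map_comp_poly rmorphD /= map_polyX map_polyC /=.
  by rewrite [ps0 _]psC0 -map_poly_comp /E -map_poly_comp; congr ((_ \Po _)`_i).
have E0 : E != 0.
  apply: contraTneq (f_mon) => /(congr1 (fun p => p \Po ('X - c%:P))).
  rewrite /E -comp_polyA comp_polyD comp_polyX comp_polyC subrK comp_polyXr.
  rewrite comp_poly0 => /eqP; rewrite map_poly_eq0 => /eqP e0.
  have := monic_map (@ps0 A) f_mon; rewrite -/e e0 monicE lead_coef0.
  by rewrite eq_sym oner_eq0.
have exE : exists k, E`_k != 0.
  by exists (size E).-1; rewrite -/(lead_coef E) lead_coef_eq0.
case: (ex_minnP exE) => m Em mmin.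
have m_gt0 : (0 < m)%N.
  rewrite lt0n; apply: contraNneq Em => ->.
  by rewrite coef_comp_XaddC nderivn0; apply: rc.
have [||B [j [q [g [algj q_gt0 rg]]]]] := newton_puiseux m_gt0 (f := f4).
- move=> i im; rewrite f40; apply/eqP; apply: contraLR im => /mmin.
  by rewrite leqNgt.
- by rewrite f40.
pose phi2 : {rmorphism pser B1 -> pser B} := psmap j q.
exists B, (j \o i1), q, (g + phi2 (psC c)).
split=> //; first exact: dalg_comp.
rewrite (eq_map_poly (g := phi2 \o psi1)) => [|x]; last first.
  by rewrite /= psmap_comp // muln1.
move: rg; rewrite /root map_comp_poly rmorphD /= map_polyX map_polyC /=.
by rewrite horner_comp !hornerE map_poly_comp.
Qed.

(** * Laurent series as fractions of power series *)

Lemma common_denominator (R : idomainType) (I : finType)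
    (y : I -> {fraction R}) :
  exists d, d != 0 /\
    exists z : I -> R, forall i, y i * tofrac d = tofrac (z i).
Proof.
have /boolp.choice[c cP] : forall i, exists c : R * R,
    c.2 != 0 /\ y i = tofrac c.1 / tofrac c.2.
  by move=> i; have [p [q [q0 ->]]] := fracP (y i); exists (p, q).
exists (\prod_i (c i).2); split.
  by apply/prodf_neq0 => i _; case: (cP i).
exists (fun i => (c i).1 * \prod_(j | j != i) (c j).2) => i.
have [q0 ->] := cP i; rewrite (bigD1 i) //= !tofracM mulrA divfK //.
by rewrite tofrac_eq0.
Qed.

Section FractionMap.
Variables (R : idomainType) (Q : fieldType) (phi : {rmorphism R -> Q}).

Lemma fraction_rmorphism : (forall x, phi x = 0 -> x = 0) ->
  exists theta : {rmorphism {fraction R} -> Q},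
    forall x, theta (tofrac x) = phi x.
Proof.
move=> phi_inj; apply: rmorphism_of_fractions => [x|f].
  split=> [/eqP|/phi_inj ->]; last by rewrite rmorph0.
  by rewrite tofrac_eq0 => /eqP ->; rewrite rmorph0.
have [p [q [q0 ->]]] := fracP f; exists p, q.
by rewrite tofrac_eq0.
Qed.

End FractionMap.

(** Clearing denominators and scaling the unknown by the leading coefficient reduces to the monic
    case over power series. *)
Theorem newton_puiseux_fraction n (A : dfield n)
    (P : {poly {fraction pser A}}) : (1 < size P)%N ->
  exists (B : dfield n) (j : {rmorphism A -> B}) (q : nat)
    (theta : {rmorphism {fraction pser A} -> {fraction pser B}}) g,
    [/\ dalg j, (0 < q)%N,
      forall x, theta (tofrac x) = tofrac (psmap j q x)
    & root (map_poly theta P) g].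
Proof.
move=> P_gt1; set d := (size P).-1.
have sizeP : size P = d.+1 by rewrite /d; case: (size P) P_gt1.
have d_gt0 : (0 < d)%N by rewrite -ltnS -sizeP.
have [D [D0 [z zP]]] := common_denominator (fun i : 'I_d.+1 => P`_i).
pose a (i : nat) := z (inord i).
have aP i : (i <= d)%N -> tofrac (a i) = P`_i * tofrac D.
  by move=> id; rewrite /a -zP inordK.
have ad0 : a d != 0.
  rewrite -tofrac_eq0 aP // mulf_neq0 ?tofrac_eq0 //.
  by rewrite -/(lead_coef P) lead_coef_eq0 -size_poly_gt0 sizeP.
(* [D * a_d ^ (d-1) * P (Y) = f (a_d * Y)] *)
pose f := 'X^d + \poly_(i < d) (a i * a d ^+ (d.-1 - i)).
have size_f : size f = d.+1.
  by rewrite size_addl size_polyXn // ltnS size_poly.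
have f_mon : f \is monic.
  by rewrite monicE /lead_coef size_f coefD coefXn eqxx coef_poly ltnn addr0.
have [|B [j [q [g [algj q_gt0 rg]]]]] := newton_puiseux_monic f_mon.
  by rewrite size_f ltnS.
pose psi : {rmorphism pser A -> pser B} := psmap j q.
have [|theta thetaE] := @fraction_rmorphism _ _ ((@tofrac (pser B)) \o psi).
  move=> x /= /eqP; rewrite tofrac_eq0 psmap_inj => /eqP //.
exists B, j, q, theta, (tofrac g / theta (tofrac (a d))); split=> //.
set b := theta (tofrac (a d)).
have b0 : b != 0 by rewrite fmorph_eq0 tofrac_eq0.
have tD : theta (tofrac D) != 0 by rewrite fmorph_eq0 tofrac_eq0.
have scale0 : theta (tofrac D) * b ^+ d.-1 != 0 by rewrite mulf_neq0 ?expf_neq0.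
apply/eqP/(mulfI scale0); rewrite mulr0.
have <- : tofrac ((map_poly psi f).[g]) = 0 :> {fraction pser B}.
  by rewrite (rootP rg) tofrac0.
rewrite (@horner_coef_wide _ d.+1); last by rewrite size_map_poly sizeP.
rewrite (@horner_coef_wide _ d.+1 (map_poly psi f)); last first.
  by rewrite (leq_trans (size_poly _ _)) // size_f.
rewrite mulr_sumr rmorph_sum; apply: eq_bigr => i _ /=.
rewrite !coef_map /= coefD coefXn coef_poly !tofracM tofracXn.
rewrite -[tofrac (psmap _ _ _)]thetaE.
have e : theta (tofrac D) * theta P`_i = theta (tofrac (a i)).
  by rewrite aP -1?ltnS // mulrC rmorphM.
rewrite expr_div_n; have [lt_id|ge_id] := ltnP i d.
  rewrite ltn_eqF //.
  rewrite add0r tofracM tofracXn rmorphM rmorphXn /= -/b -e.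
  rewrite (_ : d.-1 = (d.-1 - i) + i)%N ?addnK; last first.
    by rewrite subnK // -ltnS prednK.
  have cancel (F : fieldType) (x y v t u : F) :
      x != 0 -> y * (v * x) * (t * (u / x)) = y * t * v * u.
    by move=> x0; field.
  by rewrite exprD cancel ?expf_neq0.
have id_eq : nat_of_ord i = d.
  by apply/eqP; rewrite eqn_leq ge_id -ltnS ltn_ord.
rewrite id_eq in e *; rewrite eqxx addr0 !rmorph1 mul1r.
have bd : b ^+ d = b * b ^+ d.-1 by rewrite -exprS prednK.
have cancel (F : fieldType) (x y u : F) :
    x != 0 -> y != 0 -> x * (y * (u / (x * y))) = u.
  by move=> x0 y0; field; rewrite ?x0 ?y0.
by rewrite mulrACA e -/b bd cancel ?expf_neq0.
Qed.

(** * Good pairs in coordinates and their leading coefficients *)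

(** The linear equations with coefficients [C s] encode omega /\ Omega = 0, one for each coefficient
    of the wedge, which keeps exterior algebra out of the descent. *)
Definition affine_forms n (I : Type) (F : fieldType) (D : 'I_n -> F -> F)
    (C : I -> 'I_n -> F) (w a : 'I_n -> F) : Prop :=
  [/\ exists i, w i != 0,
      forall s, \sum_i w i * C s i = 0,
      forall i j, D i (w j) - D j (w i) = a i * w j - a j * w i
    & forall i j, D i (a j) = D j (a i)].

(** Used in both directions: down to a subfield that contains the coefficients of the forms, and up
    into Laurent series. *)
Lemma affine_forms_transfer n (I : Type) (F E : fieldType)
    (DF : 'I_n -> F -> F) (DE : 'I_n -> E -> E) (h : {rmorphism F -> E})
    (C : I -> 'I_n -> F) w a : (forall k x, DE k (h x) = h (DF k x)) ->
  affine_forms DF C w a <->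
  affine_forms DE (fun s i => h (C s i)) (h \o w) (h \o a).
Proof.
move=> hD.
have sumE s : \sum_i (h \o w) i * h (C s i) = h (\sum_i w i * C s i).
  by rewrite rmorph_sum; apply: eq_bigr => k _; rewrite rmorphM.
split=> -[[i wi] wC dw da]; split.
- by exists i; rewrite fmorph_eq0.
- by move=> s; rewrite sumE wC rmorph0.
- by move=> k l /=; rewrite !hD -!rmorphM -!rmorphB dw.
- by move=> k l /=; rewrite !hD da.
- by exists i; rewrite fmorph_eq0 in wi.
- by move=> s; apply: (fmorph_inj h); rewrite -sumE wC rmorph0.
- move=> k l; apply: (fmorph_inj h); move: (dw k l) => /=.
  by rewrite !hD -!rmorphM -!rmorphB.
- by move=> k l; apply: (fmorph_inj h); move: (da k l); rewrite /= !hD.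
Qed.

Section LeadingCoefficients.
Variables (n : nat) (B : dfield n).
Local Notation Q := {fraction pser B}.
Local Notation X m := (tofrac (psXn B m)).

Lemma psXn_factor (d : pser B) : d != 0 ->
  exists v u, u \is a GRing.unit /\ d = psXn B v * u.
Proof.
case/ps_neq0 => v [dv dlt]; exists v, (psshift v d); split.
  by rewrite ps_unitE.
exact/psdvdP.
Qed.

(** The common order of the family is [b - a]; two natural exponents stand for one integer. The unit
    part of a common denominator is absorbed in [z]. *)
Lemma leading_terms (y : 'I_n -> Q) : (exists i, y i != 0) ->
  exists a b (z : 'I_n -> pser B),
    (forall i, y i * X a = X b * tofrac (z i)) /\ exists i, ps0 (z i) != 0.
Proof.
case=> i0 yi0; have [d [d0 [z zP]]] := common_denominator y.
have [a [u [uU dE]]] := psXn_factor d0.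
pose z1 i := z i / u.
have z1P i : y i * X a = tofrac (z1 i).
  have u0 : tofrac u != 0.
    by rewrite tofrac_eq0; apply: contraTneq uU => ->; rewrite unitr0.
  by apply: (mulIf u0); rewrite -tofracM divrK // -zP dE tofracM mulrA.
have exb : exists b, [exists i, z1 i b != 0].
  have : z1 i0 != 0.
    by rewrite -tofrac_eq0 -z1P mulf_neq0 ?tofrac_eq0 ?psXn_neq0.
  by case/ps_neq0 => b [zb _]; exists b; apply/existsP; exists i0.
case: (ex_minnP exb) => b /existsP[i1 zb] bmin.
have zdvd i : psdvd b (z1 i).
  move=> l lb; apply/eqP; apply: contraLR lb => zl; rewrite -leqNgt.
  by apply: bmin; apply/existsP; exists i.
exists a, b, (fun i => psshift b (z1 i)); split; last by exists i1.
by move=> i; rewrite z1P -tofracM -(psdvdP _ _).1.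
Qed.

Variable eta : 'I_n -> pser B.
Hypothesis eta_closed : forall i j, der i (ps0 (eta j)) = der j (ps0 (eta i)).

Definition frac_psder k : Q -> Q := frac_der (psder (der k) (eta k)).
Local Notation d k := (psder (der k) (eta k)).

Let psd k x y : psder (der k) (eta k) (x + y) =
  psder (der k) (eta k) x + psder (der k) (eta k) y.
Proof. by apply: psderD; apply: derD. Qed.

Let psm k x y : psder (der k) (eta k) (x * y) =
  psder (der k) (eta k) x * y + x * psder (der k) (eta k) y.
Proof. by apply: psderM; [apply: derD | apply: derM]. Qed.

Lemma frac_psderD k x y :
  frac_psder k (x + y) = frac_psder k x + frac_psder k y.
Proof. exact: frac_derD. Qed.

Lemma frac_psderM k x y :
  frac_psder k (x * y) = frac_psder k x * y + x * frac_psder k y.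
Proof. exact: frac_derM. Qed.

Lemma frac_psder_tofrac k x : frac_psder k (tofrac x) = tofrac (d k x).
Proof. exact: frac_der_tofrac. Qed.

Lemma frac_psderX k m : frac_psder k (X m) = m%:R * tofrac (eta k) * X m.
Proof.
rewrite frac_psder_tofrac psderXn; [|exact: derD|exact: derM].
by rewrite -mulr_natl tofracM tofracM tofracMn tofrac1 mulrA.
Qed.

Lemma X_neq0 m : X m != 0 :> Q.
Proof. by rewrite tofrac_eq0 psXn_neq0. Qed.

(** The rule d(u^(b-a) z) = u^(b-a) (dz + (b-a) eta z), without negative powers. *)
Let dX (y z : Q) a b k : y * X a = X b * z ->
  frac_psder k y * X a =
  X b * (frac_psder k z + (b%:R - a%:R) * tofrac (eta k) * z).
Proof.
move=> e; have := congr1 (frac_psder k) e.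
rewrite !frac_psderM !frac_psderX => e'.
have -> : frac_psder k y * X a =
    (frac_psder k y * X a + y * (a%:R * tofrac (eta k) * X a))
    - a%:R * tofrac (eta k) * (y * X a) by ring.
by rewrite e' e; ring.
Qed.

Variables (I : Type) (C : I -> 'I_n -> B).

Lemma affine_forms_leading (w a : 'I_n -> Q) :
  affine_forms frac_psder (fun s i => tofrac (psC (C s i))) w a ->
  exists w0 a0, affine_forms (@der n B) C w0 a0.
Proof.
case=> w_neq0 wC dw da.
have [e [b [W [WE [i0 Wi0]]]]] := leading_terms w_neq0.
pose r : pser B := b%:R - e%:R.
have WC s : \sum_i ps0 (W i) * C s i = 0.
  have : tofrac (\sum_i W i * psC (C s i)) = 0 :> Q.
    apply: (mulfI (X_neq0 b)); rewrite mulr0 -(mul0r (X e)) -(wC s) rmorph_sum.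
    rewrite mulr_sumr mulr_suml; apply: eq_bigr => i _.
    by rewrite [RHS]mulrAC WE rmorphM /= mulrA.
  move/eqP; rewrite tofrac_eq0 => /eqP/(congr1 (@ps0 B)).
  rewrite rmorph_sum rmorph0 => WC0; rewrite -[RHS]WC0; apply: eq_bigr => i _.
  by rewrite rmorphM /= [ps0 (psC _)]psC0.
have rE : tofrac r = b%:R - e%:R :> Q.
  by rewrite /r tofracB !tofracMn tofrac1.
pose r0 : B := b%:R - e%:R.
have r0E : ps0 r = r0 by rewrite /r rmorphB !rmorph_nat.
have dr0 k : der k r0 = 0.
  rewrite (derivationB (derD k)) !(derivation_nat (derD k) (derM k)).
  exact: subrr.
(* The equation dw = a /\ w with the common power u^(b-e) cancelled. *)
clearbody r; have dW i j : tofrac (d i (W j) + r * eta i * W j -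
    (d j (W i) + r * eta j * W i)) = a i * tofrac (W j) - a j * tofrac (W i).
  apply: (mulfI (X_neq0 b)).
  rewrite tofracB !tofracD !tofracM -!frac_psder_tofrac rE [LHS]mulrBr.
  rewrite -(dX i (WE j)) -(dX j (WE i)) -mulrBl dw mulrBl [RHS]mulrBr.
  by rewrite -!mulrA !WE !(mulrCA (X b)).
(* Either [a] has no pole, or it has a pole of order [s > 0] with leading coefficients
   [ps0 (A i)]. *)
have [[A AE]|[s [A [s_gt0 [AE [i1 Ai1]]]]]] :
    (exists A : 'I_n -> pser B, forall i, a i = tofrac (A i)) \/
    (exists s (A : 'I_n -> pser B), (0 < s)%N /\
      (forall i, a i * X s = tofrac (A i)) /\ exists i, ps0 (A i) != 0).
- have [/forallP a0|] := boolP [forall i, a i == 0].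
    by left; exists (fun=> 0) => i; rewrite tofrac0; apply/eqP.
  rewrite negb_forall => /existsP/leading_terms[e' [b' [A [AE Ai1]]]].
  have [le_eb|lt_be] := leqP e' b'.
    left; exists (fun i => psXn B (b' - e') * A i) => i.
    apply: (mulIf (X_neq0 e')); rewrite AE -{1}(subnK le_eb) psXnD !tofracM.
    by ring.
  right; exists (e' - b')%N, A; rewrite subn_gt0; split=> //; split=> // i.
  apply: (mulIf (X_neq0 b')).
  by rewrite -mulrA -tofracM -psXnD subnK 1?ltnW // AE mulrC.
(* No pole: the constant coefficient of [dW] reads dw_0 = (a_0 - r0 eta(0)) /\ w_0. *)
- exists (fun i => ps0 (W i)), (fun i => ps0 (A i) - r0 * ps0 (eta i)).
  split=> [||i j|i j]; [by exists i0 | exact: WC | |].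
    have := dW i j; rewrite !AE -!tofracM -tofracB => /eqP; rewrite tofrac_eq.
    move/eqP/(congr1 (@ps0 B)).
    rewrite !(rmorphB, rmorphD, rmorphM) /= !ps0_psder r0E => e1.
    have -> : der i (ps0 (W j)) - der j (ps0 (W i)) =
      der i (ps0 (W j)) + r0 * ps0 (eta i) * ps0 (W j)
      - (der j (ps0 (W i)) + r0 * ps0 (eta j) * ps0 (W i))
      - r0 * ps0 (eta i) * ps0 (W j) + r0 * ps0 (eta j) * ps0 (W i) by ring.
    by rewrite e1; ring.
  rewrite !(derivationB (derD _)) !derM !dr0 !mul0r !add0r eta_closed.
  congr (_ - _).
  have := da i j; rewrite !AE !frac_psder_tofrac => /eqP; rewrite tofrac_eq.
  by move/eqP/(congr1 (@ps0 B)); rewrite !ps0_psder.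
(* Pole: multiplied by u^s, the left side of [dW] has no constant coefficient, so a_0 /\ w_0 = 0. *)
have AW i j : ps0 (A i) * ps0 (W j) = ps0 (A j) * ps0 (W i).
  have aWE k l : a k * tofrac (W l) * X s = tofrac (A k) * tofrac (W l).
    by rewrite mulrAC AE.
  have := congr1 ( *%R^~ (X s)) (dW i j); rewrite mulrBl !aWE.
  rewrite -!tofracM -tofracB => /eqP; rewrite tofrac_eq => /eqP.
  move/(congr1 (@ps0 B)); rewrite !(rmorphB, rmorphM) /= [ps0 (psXn _ _)]psXnE.
  by rewrite ltn_eqF // mulr0 => /esym/eqP; rewrite subr_eq0 => /eqP.
exists (fun i => ps0 (A i)), (fun i => s%:R * ps0 (eta i)).
split=> [|t|i j|i j]; first by exists i1.
(* Being proportional to w_0, the form a_0 satisfies the same linear equations. *)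
- apply: (mulfI Wi0); rewrite mulr0 mulr_sumr.
  rewrite (eq_bigr (fun i => ps0 (A i0) * (ps0 (W i) * C t i))) => [|i _].
    by rewrite -mulr_sumr WC mulr0.
  by rewrite mulrCA mulrA [_ * ps0 (W i0)]AW -mulrA.
(* The lowest coefficient of da = 0 reads da_0 = s eta(0) /\ a_0. *)
- have AE' k : a k * X s = X 0 * tofrac (A k) by rewrite AE psXn0 tofrac1 mul1r.
  have := congr1 ( *%R^~ (X s)) (da i j).
  have sE : 0%:R - s%:R = tofrac (- s%:R) :> Q.
    by rewrite sub0r tofracN tofracMn tofrac1.
  rewrite !(dX _ (AE' _)) !sE !frac_psder_tofrac psXn0 tofrac1 !mul1r.
  rewrite -!tofracM -!tofracD => /eqP; rewrite tofrac_eq => /eqP.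
  move/(congr1 (@ps0 B)); rewrite !(rmorphD, rmorphM, rmorphN) /= !rmorph_nat.
  rewrite !ps0_psder => e1; apply/eqP; rewrite subr_eq; apply/eqP.
  have -> : der i (ps0 (A j)) = (der i (ps0 (A j)) +
    - s%:R * ps0 (eta i) * ps0 (A j)) + s%:R * ps0 (eta i) * ps0 (A j) by ring.
  by rewrite e1; ring.
- by rewrite !derM !(derivation_nat (derD _) (derM _)) !mul0r !add0r eta_closed.
Qed.

End LeadingCoefficients.

(** * Descent through one extension *)

Lemma derivation_ext_unique (F S E : fieldType) (i : {rmorphism F -> S})
    (s : {rmorphism S -> E}) (dS : S -> S) (dE : E -> E) x :
  [pchar F] =i pred0 ->
  (forall y z, dS (y + z) = dS y + dS z) ->
  (forall y z, dS (y * z) = dS y * z + y * dS z) ->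
  (forall y z, dE (y + z) = dE y + dE z) ->
  (forall y z, dE (y * z) = dE y * z + y * dE z) ->
  (forall c, dE (s (i c)) = s (dS (i c))) -> algebraicOver i x ->
  dE (s x) = s (dS x).
Proof.
move=> char0 dSD dSM dED dEM agree algx; apply/eqP; rewrite -subr_eq0.
(* The defect [d] is a derivation along [s] that vanishes on [F]. *)
apply/eqP; pose d x := dE (s x) - s (dS x); rewrite -/(d x).
apply: (@twisted_derivation_eq0 _ _ _ i s d x) => //.
- by move=> y z; rewrite /d !(rmorphD, dSD, dED) opprD addrACA.
- by move=> y z; rewrite /d !(rmorphM, rmorphD, dSM, dEM); ring.
- by move=> c; rewrite /d agree subrr.
Qed.

(** The primitive element theorem, applied one element at a time. *)
Lemma finitely_generated_simple (F E : fieldType) (h : {rmorphism F -> E})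
    (s : seq E) :
  [pchar F] =i pred0 -> (forall x, algebraicOver h x) ->
  exists z, forall x, x \in s -> exists q, x = (map_poly h q).[z].
Proof.
move=> char0 alg; elim: s => [|y s [z zP]]; first by exists 0.
have [p p0 pz] := alg z; have [q q0 qy] := alg y.
have [m [[r1 r1E] [r2 r2E]]] := pchar0_PET p0 pz q0 qy char0.
exists (y *+ m - z) => x; rewrite in_cons => /predU1P[->|/zP[r ->]].
  by exists r2.
by exists (r \Po r1); rewrite map_comp_poly horner_comp r1E.
Qed.

(** [S] is F(z), presented as F[X]/(p) for the minimal polynomial p. The last clause turns a Puiseux
    root of p into an embedding of F(z) into Laurent series. *)
Lemma simple_subextension n (F E : dfield n) (h : {rmorphism F -> E}) (z : E) :
  dalg h ->
  exists (p : {poly F}) (S : fieldExtType F) (D : 'I_n -> S -> S)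
    (s : {rmorphism S -> E}),
  [/\ (1 < size p)%N,
      commuting_derivations D /\
        forall k c, D k (in_alg S c) = in_alg S (der k c),
      (forall k x, der k (s x) = s (D k x)) /\ forall c, s (in_alg S c) = h c,
      (forall x, algebraicOver (in_alg S) x) /\
        forall q, exists x, s x = (map_poly h q).[z]
    & forall (Q : fieldType) (theta : {rmorphism F -> Q}) g,
        root (map_poly theta p) g ->
        exists phi : {rmorphism S -> Q}, forall c, phi (in_alg S c) = theta c].
Proof.
case=> dh algh; have char0 := @dpchar0 _ F.
have [p [irr pz _ p_dvd]] := minimal_polynomial char0 (algh z).
have p0 := irredp_neq0 irr.
pose S : fieldExtType F := SubFieldExtType pz irr.
pose s : {rmorphism S -> E} := @subfx_inj F E h z p.
have sE c : s (in_alg S c) = h c by exact: subfx_inj_base.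
have algS x : algebraicOver (in_alg S) x.
  apply: (@algebraicOver_sub _ _ _ (in_alg S) s); have [q q0 qx] := algh (s x).
  exists q => //; rewrite (eq_map_poly (g := h)) // => c; exact: sE.
have gen (x : S) : exists q, x = (map_poly (in_alg S) q).[subfx_root h z p].
  by have [q qE] := subfxEroot pz p0 x; exists q.
have [D [DP DE]] := dfield_simple_ext (algS (subfx_root h z p)) gen.
exists p, S, D, s; split=> //.
- by case: (irr).
- split=> // k x; case: (DP) => DD DM _.
  apply: (@derivation_ext_unique _ _ _ (in_alg S) s (D k) (@der _ E k)) => //.
  + by move=> ? ?; apply: derD.
  + by move=> ? ?; apply: derM.
  + by move=> c; rewrite DE sE dh -sE.
- by split=> // q; exists (subfx_eval h z p q); apply: (subfx_inj_eval pz p0).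
move=> Q theta g pg.
pose ev : {rmorphism {poly F} -> S} := @subfx_eval F E h z p.
pose rho : {rmorphism {poly F} -> Q} := horner_eval g \o map_poly theta.
have evE q : s (ev q) = (map_poly h q).[z] := subfx_inj_eval pz p0 q.
have rhoE q : rho q = (map_poly theta q).[g] by [].
have ev0 q : ev q = 0 <-> p %| q.
  split=> [e|].
    by apply: p_dvd; apply/rootP; rewrite -evE e rmorph0.
  case/dvdpP => r ->; apply: (fmorph_inj s); rewrite rmorph0.
  by rewrite evE rmorphM hornerM (rootP pz) mulr0.
have [||phi phiE] := @rmorphism_of_fractions _ _ _ ev rho.
- move=> q; rewrite ev0; split=> [/dvdpP[r ->]|e].
    by rewrite rhoE rmorphM hornerM (rootP pg) mulr0.
  (* If [p] did not divide [q], Bezout would give 1 = 0 at [g]. *)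
  apply: contrapT => /negP; rewrite -irreducible_poly_coprime //.
  case/Bezout_eq1_coprimepP => -[u v] /= uv.
  have := rmorph1 rho; rewrite -uv (rmorphD rho) !(rmorphM rho) e mulr0 addr0.
  by rewrite [rho p]rhoE (rootP pg) mulr0 => /esym/eqP; rewrite oner_eq0.
- move=> x; have [q ->] := subfxE x; exists q, 1.
  by rewrite rmorph1 divr1 oner_neq0.
exists phi => c; rewrite (_ : in_alg S c = ev c%:P).
  by rewrite phiE rhoE map_polyC hornerC.
apply: (fmorph_inj s); rewrite sE evE.
by rewrite map_polyC hornerC.
Qed.

Section Descent.
Variables (n : nat) (K : dfield n) (I : Type) (V : I -> 'I_n -> K).

Definition has_affine_forms (E : dfield n) (c : K -> E) : Prop :=
  exists w a, affine_forms (@der n E) (fun s i => c (V s i)) w a.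

(** The invariant carried up the tower. Quantifying over all algebraic extensions of [N] makes
    algebraic steps immediate. *)
Definition descends (N : dfield n) (c : {rmorphism K -> N}) : Prop :=
  forall (E : dfield n) (h : {rmorphism N -> E}), dalg h ->
    has_affine_forms (h \o c) ->
  exists (E0 : dfield n) (h0 : {rmorphism K -> E0}),
    dalg h0 /\ has_affine_forms h0.

Lemma descends_algebraic (N N1 : dfield n) (c : {rmorphism K -> N})
    (i : {rmorphism N -> N1}) : dalg i -> descends c -> descends (i \o c).
Proof.
by move=> algi desc E h algh; apply: (desc E (h \o i)); apply: dalg_comp.
Qed.

(** Both transcendental steps have this form: an exponential with [gamma = 0], and a primitive t
    with s = 1/t and [beta = 0]. As N1 = N(s) with s transcendental, s |-> u embeds N1 in Laurent
    series over [N]. *)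
Lemma descends_transcendental (N N1 : dfield n) (c : {rmorphism K -> N})
    (i : {rmorphism N -> N1}) (s : N1) (beta gamma : 'I_n -> N) :
  dmorph i -> ~ algebraicOver i s ->
  (forall k, der k s = i (beta k) * s + i (gamma k) * s ^+ 2) ->
  (forall k l, der k (beta l) = der l (beta k)) ->
  (forall x, exists a b, (map_poly i b).[s] != 0 /\
     x = (map_poly i a).[s] / (map_poly i b).[s]) ->
  descends c -> descends (i \o c).
Proof.
move=> di trs ds dbeta frac desc E h algh [w [a waP]].
have charN := @dpchar0 _ N.
pose ev : {rmorphism {poly N} -> N1} := horner_eval s \o map_poly i.
have ev_inj q : ev q = 0 -> q = 0.
  move=> e; apply/eqP/negPn/negP => q0; apply: trs; exists q => //.
  exact/eqP.
pose rho : {rmorphism {poly N} -> {fraction pser N}} :=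
  (@tofrac (pser N)) \o (@pspoly N).
have [||theta0 theta0E] := @rmorphism_of_fractions _ _ _ ev rho.
- move=> q; split=> [/ev_inj ->|/eqP]; first by rewrite rmorph0.
  by rewrite tofrac_eq0 pspoly_eq0 => /eqP ->; rewrite rmorph0.
- exact: frac.
(* The finitely many coefficients of the forms lie in a simple extension [S] of [N1]. *)
have [z zP] := finitely_generated_simple
  ([seq w k | k : 'I_n] ++ [seq a k | k : 'I_n]) (@dpchar0 _ N1) algh.2.
have [p [S [D [sE [p_gt1 [DP DE] [sD sEh] [algS gen] univ]]]]] :=
  simple_subextension z algh.
have /boolp.choice[w1 w1E] : forall k, exists x, sE x = w k.
  move=> k; have [|q ->] := zP (w k); last exact: gen.
  by rewrite mem_cat fintype.image_f.
have /boolp.choice[a1 a1E] : forall k, exists x, sE x = a k.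
  move=> k; have [|q ->] := zP (a k); last exact: gen.
  by rewrite mem_cat orbC fintype.image_f.
have size_tp : (1 < size (map_poly theta0 p))%N by rewrite size_map_poly.
(* A Puiseux root of [p] yields an embedding of [S] in which s |-> u^q. *)
have [B [j [q [theta [g [algj q_gt0 thetaE rg]]]]]] :=
  newton_puiseux_fraction size_tp.
have [|phi phiE] := univ _ (theta \o theta0) g.
  by rewrite map_poly_comp.
(* [u ^ q = s] and [D s = beta * s + gamma * s ^ 2] force [D u = eta * u] *)
pose eta k : pser B :=
  psC (j (beta k) / q%:R) + psC (j (gamma k) / q%:R) * psXn B q.
have q0 : q%:R != 0 :> B by rewrite ((pcharf0P B).1 (@dpchar0 _ B)) -lt0n.
have dq k : der k (q%:R : B) = 0.
  by apply: derivation_nat; [apply: derD | apply: derM].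
have eta0 k : ps0 (eta k) = j (beta k) / q%:R.
  rewrite /eta rmorphD rmorphM /= [ps0 (psXn _ _)]psXnE ltn_eqF //.
  by rewrite mulr0 addr0 [LHS]psC0.
have eta_closed k l : der k (ps0 (eta l)) = der l (ps0 (eta k)).
  rewrite !eta0 !derM !(derivationV (derD _) (derM _)) !dq oppr0 mul0r !mulr0.
  by rewrite !addr0 !algj.1 dbeta.
pose tau : {rmorphism N1 -> {fraction pser B}} := theta \o theta0.
have tau_i y : tau (i y) = tofrac (psC (j y)).
  have -> : i y = ev y%:P by rewrite /ev /= map_polyC /horner_eval hornerC.
  by rewrite /tau /= theta0E /rho /= thetaE psmap_C.
have tau_s : tau s = tofrac (psXn B q).
  have -> : s = ev 'X by rewrite /ev /= map_polyX /horner_eval hornerX.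
  rewrite /tau /= theta0E /rho /= thetaE -['X]expr1 psmap_Xn //.
  by rewrite muln1.
(* The embedding respects the derivations: on [N] and at [s] by computation, then on polynomials in
   [s], on fractions, and on [S] by uniqueness. *)
pose dQ := frac_psder eta.
have dQD k x y : dQ k (x + y) = dQ k x + dQ k y by apply: frac_psderD.
have dQM k x y : dQ k (x * y) = dQ k x * y + x * dQ k y by apply: frac_psderM.
have dtau_i k y : dQ k (tau (i y)) = tau (der k (i y)).
  rewrite di !tau_i /dQ frac_psder_tofrac psderC ?algj.1 //.
  exact: derD.
have dtau_s k : dQ k (tau s) = tau (der k s).
  rewrite ds expr2 rmorphD !rmorphM !tau_i tau_s /dQ frac_psderX.
  have qE : q%:R = tofrac (psC q%:R) :> {fraction pser B}.
    by rewrite !rmorph_nat.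
  rewrite qE -!tofracM -tofracD; congr (tofrac _).
  have qC (y : B) : psC (q%:R : B) * psC (y / q%:R) = psC y.
    by rewrite -rmorphM mulrC divfK.
  by rewrite /eta mulrDr qC [psC q%:R * (_ * _)]mulrA qC mulrDl mulrA.
have dtau_ev k r : dQ k (tau (ev r)) = tau (der k (ev r)).
  elim/poly_ind: r => [|r y IH].
    rewrite rmorph0 rmorph0 (derivation0 (derD k)) rmorph0.
    exact: (derivation0 (dQD k)).
  have -> : ev (r * 'X + y%:P) = ev r * s + i y.
    rewrite rmorphD rmorphM /= /horner_eval map_polyX map_polyC hornerX.
    by rewrite hornerC.
  rewrite !(rmorphD, rmorphM) /= dQD dQM derD derM IH dtau_s dtau_i.
  by rewrite !(rmorphD, rmorphM).
have dtau k x : dQ k (tau x) = tau (der k x).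
  have [r1 [r2 [r20 ->]]] := frac x; rewrite -[(map_poly i r1).[s]]/(ev r1).
  rewrite -[(map_poly i r2).[s]]/(ev r2) in r20 *.
  rewrite derM (derivationV (derD k) (derM k)) rmorphM fmorphV dQM.
  rewrite (derivationV (dQD k) (dQM k)) !dtau_ev.
  by rewrite rmorphD !rmorphM fmorphV rmorphN fmorphV rmorphXn.
have dphi k x : dQ k (phi x) = phi (D k x).
  case: (DP) => DD DM _.
  apply: (derivation_ext_unique (@dpchar0 _ N1)) (algS x) => // y.
  by rewrite phiE dtau DE phiE.
apply: (desc B j algj).
have waS : affine_forms D (fun t k => in_alg S (i (c (V t k)))) w1 a1.
  apply/(affine_forms_transfer _ _ _ sD).
  rewrite (_ : sE \o w1 = w); last by apply/funext => k; apply: w1E.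
  rewrite (_ : sE \o a1 = a); last by apply/funext => k; apply: a1E.
  rewrite (_ : (fun _ _ => _) = fun t k => h (i (c (V t k)))) //.
  by apply/funext => t; apply/funext => k; apply: sEh.
have /(affine_forms_transfer _ _ _ dphi) := waS.
rewrite (_ : (fun _ _ => _) = fun t k => tofrac (psC (j (c (V t k))))).
  exact: (@affine_forms_leading _ B eta).
apply/funext => t; apply/funext => k; rewrite -tau_i; exact: phiE.
Qed.

End Descent.

(** * Coefficients of differential forms *)

Section FormCoefficients.
Variables (n : nat) (L : fieldType).
Implicit Types (S A B : {set 'I_n}) (u v w : dform n L).

(** The coefficient at [S] of dx_i /\ v; see [wedge_dxE]. *)
Definition contraction_coef v S (i : 'I_n) : L :=
  if i \in S then (-1) ^+ inversions [set i] (S :\ i) * v (S :\ i) else 0.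

(** Only singletons contribute to the sum that defines the wedge. *)
Lemma wedge_oneformE w v S : homogeneous 1 w ->
  wedge w v S = \sum_i w [set i] * contraction_coef v S i.
Proof.
move=> w1; rewrite ffunE.
pose G A := (-1) ^+ inversions A (S :\: A) * (w A * v (S :\: A)).
have GE A : G A = \sum_(i | A == [set i]) G A.
  have [/cards1P[x ->]|A1] := boolP (#|A| == 1%N).
    rewrite (big_pred1 x) // => i; apply/eqP/eqP => [/set1_inj ->|->] //.
  by rewrite (_ : G A = 0) ?big1 // /G w1 // mul0r mulr0.
rewrite (eq_bigr (fun A => \sum_(i | A == [set i]) G A)) => [|A _];
  last exact: GE.
rewrite (exchange_big_dep predT) //=; apply: eq_bigr => i _.
rewrite /contraction_coef; case: ifP => iS.
  rewrite (big_pred1 [set i]) => [|A]; first by rewrite /G mulrCA.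
  by rewrite /= andbC; case: eqP => [->|//]; rewrite finset.sub1set iS.
rewrite mulr0 big_pred0 // => A; rewrite andbC; case: eqP => [->|//].
by rewrite finset.sub1set iS.
Qed.

Lemma dx1 (i j : 'I_n) : dx L i [set j] = (i == j)%:R.
Proof.
rewrite ffunE; congr (_%:R); congr nat_of_bool.
by apply/eqP/eqP => [/set1_inj ->|->].
Qed.

Lemma dx_homogeneous (i : 'I_n) : homogeneous 1 (dx L i : dform n L).
Proof.
move=> S S1; rewrite ffunE; case: eqP => // e.
by rewrite e cards1 in S1.
Qed.

Lemma wedge_dxE i v S : wedge (dx L i) v S = contraction_coef v S i.
Proof.
rewrite wedge_oneformE; last exact: dx_homogeneous.
rewrite (bigD1 i) //= dx1 eqxx mul1r big1 ?addr0 // => j ji.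
by rewrite dx1 eq_sym (negPf ji) mul0r.
Qed.

Lemma extdE (D : 'I_n -> L -> L) w S :
  extd D w S = \sum_i contraction_coef [ffun T : {set 'I_n} => D i (w T)] S i.
Proof.
rewrite /extd sum_ffunE; apply: eq_bigr => i _.
exact: wedge_dxE.
Qed.

Lemma inversions_set0 A : inversions A finset.set0 = 0%N.
Proof.
apply/eqP; rewrite cards_eq0; apply/eqP/finset.setP => -[i j].
by rewrite !inE /= andbF.
Qed.

Lemma inversions_set1 (i j : 'I_n) : inversions [set i] [set j] = (j < i)%N.
Proof.
rewrite /inversions; case: ltnP => ji.
  rewrite (_ : [set _ | _] = [set (i, j)]) ?cards1 //.
  apply/finset.setP => -[k l]; rewrite !inE /= xpair_eqE.
  by case: eqP => [->|//]; case: eqP => [->|//]; rewrite ji.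
apply/eqP; rewrite cards_eq0; apply/eqP/finset.setP => -[k l]; rewrite !inE /=.
by case: eqP => [->|//]; case: eqP => [->|//]; rewrite ltnNge ji.
Qed.

Section ExteriorDerivative.
Variable D : 'I_n -> L -> L.
Hypothesis DD : forall i x y, D i (x + y) = D i x + D i y.

Lemma extd_form0 t k : extd D (form0 n t) [set k] = D k t.
Proof.
have k0 : [set k] :\ k = finset.set0.
  by apply/finset.setP => l; rewrite !inE andbC; case: eqP.
rewrite extdE (bigD1 k) //= big1 ?addr0 => [|i ik].
  rewrite /contraction_coef finset.set11 k0 inversions_set0 expr0 mul1r !ffunE.
  by rewrite cards0.
by rewrite /contraction_coef inE (negPf ik).
Qed.

Lemma extd_form0_homogeneous t : homogeneous 1 (extd D (form0 n t)).
Proof.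
move=> S S1; rewrite extdE big1 // => i _; rewrite /contraction_coef.
case: ifP => // iS; rewrite !ffunE.
case: ifP; rewrite ?(derivation0 (DD i)) ?mulr0 //.
by move: S1; rewrite (cardsD1 i S) iS add1n eqSS => /negPf ->.
Qed.

Definition oneform (w : 'I_n -> L) : dform n L :=
  [ffun S : {set 'I_n} => \sum_j (S == [set j])%:R * w j].

Lemma oneform1 (w : 'I_n -> L) j : oneform w [set j] = w j.
Proof.
rewrite ffunE (bigD1 j) //= eqxx mul1r big1 ?addr0 // => i ij.
case: eqP => [/set1_inj e|_]; last by rewrite mul0r.
by rewrite e eqxx in ij.
Qed.

Lemma oneform_homogeneous (w : 'I_n -> L) : homogeneous 1 (oneform w).
Proof.
move=> S S1; rewrite ffunE big1 // => j _.
case: eqP => [e|_]; last by rewrite mul0r.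
by rewrite e cards1 in S1.
Qed.

(** The sum of c_ij dx_i /\ dx_j vanishes because the two terms at a pair {x, y} cancel. The
    equations for d omega and d alpha both reduce to it. *)
Lemma sum_contraction_symmetric (c : 'I_n -> 'I_n -> L) S :
  (forall i j, c i j = c j i) ->
  \sum_i contraction_coef (oneform (c i)) S i = 0.
Proof.
move=> cC; have [/cards2P[x [y [xy ->]]]|S2] := boolP (#|S| == 2%N); last first.
  apply: big1 => i _; rewrite /contraction_coef; case: ifP => // iS.
  rewrite oneform_homogeneous ?mulr0 //.
  by move: S2; rewrite (cardsD1 i S) iS add1n eqSS.
have yx : y != x by rewrite eq_sym.
have Sx : [set x; y] :\ x = [set y].
  apply/finset.setP => l; rewrite !inE.
  by case: (eqVneq l x) => [->|] //=; rewrite (negPf xy).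
have Sy : [set x; y] :\ y = [set x].
  apply/finset.setP => l; rewrite !inE.
  by case: (eqVneq l y) => [->|] /=; rewrite ?(negPf yx) ?orbF.
rewrite (bigD1 x) //= (bigD1 y) //= big1 ?addr0 => [|i /andP[ix iy]].
  rewrite /contraction_coef !inE !eqxx orbT /= Sx Sy !oneform1 !inversions_set1.
  rewrite (cC y x) -mulrDl; case: (ltngtP x y) => [||/val_inj e].
  - by rewrite expr0 expr1 subrr mul0r.
  - by rewrite expr0 expr1 addNr mul0r.
  - by rewrite e eqxx in xy.
by rewrite /contraction_coef !inE (negPf ix) (negPf iy).
Qed.

Lemma extd_oneform (w : 'I_n -> L) S :
  extd D (oneform w) S =
  \sum_i contraction_coef (oneform (fun j => D i (w j))) S i.
Proof.
rewrite extdE; apply: eq_bigr => i _; rewrite /contraction_coef.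
case: ifP => // _; rewrite !ffunE (derivation_sum (DD i)); congr (_ * _).
apply: eq_bigr => j _; case: eqP => _; rewrite ?mul1r // !mul0r.
exact: derivation0.
Qed.

Lemma extd_oneform_eq0 a : (forall i j, D i (a j) = D j (a i)) ->
  extd D (oneform a) = 0.
Proof.
move=> aC; apply/ffunP => S; rewrite extd_oneform ffunE.
exact: sum_contraction_symmetric.
Qed.

Lemma extd_oneform_wedge (w a : 'I_n -> L) :
  (forall i j, D i (w j) - D j (w i) = a i * w j - a j * w i) ->
  extd D (oneform w) = wedge (oneform a) (oneform w).
Proof.
move=> dw; apply/ffunP => S; apply/eqP; rewrite -subr_eq0; apply/eqP.
rewrite extd_oneform wedge_oneformE; last exact: oneform_homogeneous.
(* d omega - alpha /\ omega is the sum of c_ij dx_i /\ dx_j with c_ij = D_i w_j - a_i w_j, symmetric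
   by hypothesis. *)
rewrite -sumrB -[RHS](@sum_contraction_symmetric
  (fun i j => D i (w j) - a i * w j) S) => [|i j].
  apply: eq_bigr => i _; rewrite oneform1 /contraction_coef.
  case: ifP => // _; last by rewrite mulr0 subrr.
  rewrite mulrCA -mulrBr; congr (_ * _); rewrite !ffunE mulr_sumr -sumrB.
  by apply: eq_bigr => j _; rewrite mulrBr [a i * (_ * _)]mulrCA.
apply/eqP; rewrite -subr_eq0; apply/eqP.
have -> : D i (w j) - a i * w j - (D j (w i) - a j * w i) =
  (D i (w j) - D j (w i)) - (a i * w j - a j * w i) by ring.
by rewrite dw subrr.
Qed.

End ExteriorDerivative.

End FormCoefficients.

Lemma contraction_coef_map n (K L : fieldType) (h : {rmorphism K -> L})
    (v : dform n K) S i :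
  contraction_coef (map_form h v) S i = h (contraction_coef v S i).
Proof.
rewrite /contraction_coef; case: ifP => _; last by rewrite rmorph0.
by rewrite ffunE rmorphM rmorph_sign.
Qed.

(** * Subfields given as sets, adjunction and finite extensions *)

Section SubfieldType.
Variables (L : fieldType) (A : set L).

Definition subfield_pred of is_subfield A : {pred L} := fun x => `[< A x >].

Variable HA : is_subfield A.

Lemma subfield_divring_closed : divring_closed (subfield_pred HA).
Proof.
have [A1 AB AV] := HA.
split=> [|x y /asboolP Ax /asboolP Ay|x y /asboolP Ax /asboolP Ay].
- exact/asboolP.
- exact/asboolP/AB.
- exact/asboolP/AV.
Qed.

HB.instance Definition _ :=
  GRing.isDivringClosed.Build L (subfield_pred HA)
    subfield_divring_closed.

Record subfield_type := SubfieldType {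
  subfield_val : L;
  subfield_valP : subfield_val \in subfield_pred HA }.

HB.instance Definition _ := [isSub for subfield_val].
HB.instance Definition _ := [Choice of subfield_type by <:].
HB.instance Definition _ :=
  [SubChoice_isSubIntegralDomain of subfield_type by <:].
HB.instance Definition _ :=
  [SubIntegralDomain_isSubField of subfield_type by <:].

End SubfieldType.

(** Makes a stage of the tower, a subset of [L], a differential field in its own right, to which the
    descent lemmas apply. *)
Lemma diff_subfield_dfield n (L : dfield n) (A : set L) :
  is_diff_subfield (@der n L) A ->
  exists (N : dfield n) (e : {rmorphism N -> L}),
    dmorph e /\ forall x, A x <-> exists y, e y = x.
Proof.
case=> HA AD; pose N : fieldType := subfield_type HA.
pose e : {rmorphism N -> L} := (val : subfield_type HA -> L).
have Ae (y : N) : A (e y) by apply/asboolP; apply: (subfield_valP y).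
have eA x : A x -> exists y : N, e y = x.
  by move=> Ax; exists (SubfieldType (introT (asboolP _) Ax)).
have /boolp.choice[D' D'E] :
    forall p : 'I_n * N, exists y, e y = der p.1 (e p.2).
  by move=> [k y]; apply/eA/AD/Ae.
pose D k y := D' (k, y).
have DE k y : e (D k y) = der k (e y) by apply: D'E.
have DP : commuting_derivations D.
  split=> [k x y|k x y|k l x]; apply: (fmorph_inj e);
    by rewrite ?(rmorphD, rmorphM) !DE ?(rmorphD, rmorphM) ?derD ?derM // derC.
have charN : [pchar N] =i pred0.
  by move=> q; rewrite -(fmorph_pchar e) (@dpchar0 _ L).
exists (DField charN DP), e; split=> [k x|x]; first by rewrite DE.
by split=> [/eA //|[y <-]].
Qed.

Lemma rmorphism_factor (N N1 L : fieldType) (e : {rmorphism N -> L})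
    (e1 : {rmorphism N1 -> L}) :
  (forall x, exists y, e1 y = e x) ->
  exists i : {rmorphism N -> N1}, forall x, e1 (i x) = e x.
Proof.
move=> sub; apply: (@rmorphism_of_rel N N1 (fun x y => e1 y = e x)) => //.
- by rewrite !rmorph1.
- by move=> x y x' y' ex ey; rewrite !rmorphB ex ey.
- by move=> x y x' y' ex ey; rewrite !rmorphM ex ey.
- by move=> y; rewrite rmorph0 => /eqP; rewrite fmorph_eq0 => /eqP.
Qed.

Section Adjoin.
Variables (N L : fieldType) (e : {rmorphism N -> L}) (s : L).

Definition rational_in (x : L) : Prop := exists a b : {poly N},
  (map_poly e b).[s] != 0 /\ x = (map_poly e a).[s] / (map_poly e b).[s].

Lemma rational_in_subfield : is_subfield rational_in.
Proof.
split.
- by exists 1, 1; rewrite rmorph1 hornerC oner_neq0 divr1.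
- move=> _ _ [a [b [b0 ->]]] [c [d [d0 ->]]]; exists (a * d - c * b), (b * d).
  rewrite rmorphB !rmorphM /= hornerD hornerN !hornerM mulf_neq0 //; split=> //.
  by rewrite -mulNr addf_div // mulNr.
- move=> _ _ [a [b [b0 ->]]] [c [d [d0 ->]]].
  have [c0|c0] := eqVneq (map_poly e c).[s] 0.
    exists 0, 1; rewrite rmorph1 rmorph0 horner0 hornerC oner_neq0 c0.
    by rewrite mul0r invr0 mulr0 mul0r.
  exists (a * d), (b * c).
  rewrite !rmorphM /= !hornerM mulf_neq0 //; split=> //.
  by rewrite invf_div mulf_div.
Qed.

(** Rational expressions in [s] form a subfield, and the adjunction is the smallest one. [t] and [s]
    are kept apart because s = 1/t in the primitive case. *)
Lemma adjoin_rational (A : set L) t x :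
  (forall y, A y -> exists z, e z = y) -> rational_in t ->
  adjoin A t x -> rational_in x.
Proof.
move=> eA rt; apply; split; first exact: rational_in_subfield.
move=> y [/eA[z <-]|->] //; exists z%:P, 1.
by rewrite rmorph1 map_polyC !hornerC oner_neq0 divr1.
Qed.

End Adjoin.

(** Multiplication by [x] acts on the spanning family by a matrix [M] over [N]; the family is an
    eigenvector for [x], which is thus a root of the characteristic polynomial. *)
Lemma finite_algebraic (N L : fieldType) (e : {rmorphism N -> L})
    (A B : set L) x :
  (forall y, A y <-> exists z, e z = y) -> is_subfield B -> finite_over A B ->
  B x -> algebraicOver e x.
Proof.
move=> eA BF [m [b [Bb span]]] Bx; have [B1 BB BV] := BF.
have BM y z : B y -> B z -> B (y * z).
  move=> By Bz; rewrite -[z]invrK; apply: (BV) => //.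
  by rewrite -[_^-1]div1r; apply: BV.
have /boolp.choice[c cP] : forall k, exists c : 'I_m -> N,
    x * b k = \sum_l e (c l) * b l.
  move=> k; have [c cA ->] := span _ (BM _ _ Bx (Bb k)).
  have /boolp.choice[c' c'E] : forall l, exists z, e z = c l.
    by move=> l; apply/eA.
  by exists c'; apply: eq_bigr => l _; rewrite c'E.
pose M : 'M[N]_m := \matrix_(l, k) c k l.
pose v : 'rV[L]_m := \row_k b k.
(* The spanning family is not zero, for 1 is in its span. *)
have v0 : v != 0.
  apply/eqP => /rowP v0; have [c1 _] := span _ B1.
  move/eqP; rewrite big1 ?oner_eq0 // => k _.
  by have := v0 k; rewrite !mxE => ->; rewrite mulr0.
exists (char_poly M); first exact: monic_neq0 (char_poly_monic M).
rewrite map_char_poly -eigenvalue_root_char; apply/eigenvalueP.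
exists v => //; apply/rowP => k; rewrite !mxE cP.
by apply: eq_bigr => l _; rewrite !mxE mulrC.
Qed.

(** * Climbing the Liouvillian tower *)

Section Tower.
Variables (n : nat) (K : dfield n) (I : Type) (V : I -> 'I_n -> K).
Variables (L : dfield n) (iota : {rmorphism K -> L}).

Definition subfield_descends (A : set L) : Prop :=
  exists (N : dfield n) (e : {rmorphism N -> L}) (c : {rmorphism K -> N}),
  [/\ dmorph e, forall x, A x <-> exists y, e y = x,
      forall x, e (c x) = iota x & descends V c].

Lemma range_descends : dmorph iota -> subfield_descends (range iota).
Proof.
move=> di; exists K, iota, idfun; split=> // [x|E h algh good].
  by split=> [[y _ <-]|[y <-]]; exists y.
by exists E, h.
Qed.

Lemma extd_coef (t : L) (d : dform n L) k :
  extd (@der n L) (form0 n t) = d -> der k t = d [set k]%SET.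
Proof. by move=> <-; rewrite extd_form0. Qed.

Lemma step_descends (A B : set L) :
  is_diff_subfield (@der n L) B -> (A `<=` B)%classic ->
  liouvillian_step (@der n L) A B ->
  subfield_descends A -> subfield_descends B.
Proof.
move=> Bdiff AB step [N [e [c [de eA ec desc]]]].
have [N1 [e1 [de1 e1B]]] := diff_subfield_dfield Bdiff.
have [|i ie] := @rmorphism_factor N N1 L e e1.
  by move=> x; apply/e1B/AB/eA; exists x.
have di : dmorph i.
  by move=> k x; apply: (fmorph_inj e1); rewrite -de1 !ie de.
exists N1, e1, (i \o c); split=> // [x|]; first by rewrite /= ie ec.
have map_e (q : {poly N}) y : (map_poly e q).[e1 y] = e1 (map_poly i q).[y].
  rewrite -horner_map -map_poly_comp /=; congr (_.[_]).
  by apply: eq_map_poly => z; rewrite /= ie.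
have frac s t : rational_in e (e1 s) t -> B = adjoin A t -> forall x,
    exists a b, (map_poly i b).[s] != 0 /\
      x = (map_poly i a).[s] / (map_poly i b).[s].
  move=> rt BE x; have : B (e1 x) by apply/e1B; exists x.
  rewrite BE => /(adjoin_rational (fun y => (eA y).1) rt)[a [b]].
  rewrite !map_e fmorph_eq0 => -[b0 ab]; exists a, b; split=> //.
  by apply: (fmorph_inj e1); rewrite fmorph_div.
(* A generator that happens to be algebraic makes the step an algebraic one. *)
have alg_gen t : algebraicOver i t ->
    (forall x, exists a b, (map_poly i b).[t] != 0 /\
      x = (map_poly i a).[t] / (map_poly i b).[t]) -> descends V (i \o c).
  move=> algt gen; apply: descends_algebraic => //; split=> // x.
  have [a [b [_ ->]]] := gen x.
  by apply: algebraic_div; apply: algebraicOver_horner.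
have self (s : N1) : rational_in e (e1 s) (e1 s).
  exists 'X, 1; rewrite rmorph1 map_polyX hornerX hornerC oner_neq0.
  by rewrite divr1.
case: step => [[t [BE t0 [delta [_ dA] dt]]]|[t [BE [delta [_ dA] dt]]]|fin].
- have [t1 t1E] : exists t1, e1 t1 = t.
    by apply/e1B; rewrite BE => M [_]; apply; right.
  have t10 : t1 != 0 by rewrite -(fmorph_eq0 e1) t1E.
  have rt := self t1; rewrite {2}t1E in rt.
  have [algt|trs] := pselect (algebraicOver i t1).
    exact: (alg_gen t1) (frac _ _ rt BE).
  have /boolp.choice[beta betaE] : forall k, exists y, e y = delta [set k]%SET.
    by move=> k; apply/eA.
  have dt1 k : der k t1 = i (beta k) * t1.
    apply: (fmorph_inj e1); rewrite -de1 t1E (extd_coef k dt) rmorphM ie betaE.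
    by rewrite t1E ffunE mulrC.
  apply: (@descends_transcendental _ _ _ _ N N1 c i t1 beta (fun=> 0)) => //.
  + by move=> k; rewrite rmorph0 mul0r addr0.
  (* That the derivations commute at [t1] gives d beta = 0 after division by [t1]. *)
  + move=> k l; apply: (fmorph_inj i); rewrite -!di; apply: (mulIf t10).
    have := derC k l t1; rewrite !dt1 !derM !dt1.
    by rewrite [i (beta l) * (_ * _)]mulrCA => /addIr.
  + exact: frac rt BE.
- have [t1 t1E] : exists t1, e1 t1 = t.
    by apply/e1B; rewrite BE => M [_]; apply; right.
  have rt := self t1; rewrite {2}t1E in rt.
  have [algt|trs] := pselect (algebraicOver i t1).
    exact: (alg_gen t1) (frac _ _ rt BE).
  have t10 : t1 != 0 by apply: contra_not_neq trs => ->; apply: algebraic0.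
  have /boolp.choice[beta betaE] : forall k, exists y, e y = delta [set k]%SET.
    by move=> k; apply/eA.
  have dt1 k : der k t1 = i (beta k).
    by apply: (fmorph_inj e1); rewrite -de1 t1E (extd_coef k dt) ie betaE.
  (* With s = 1/t, the equation dt = delta becomes ds = - delta s^2. *)
  apply: (@descends_transcendental _ _ _ _ N N1 c i t1^-1 (fun=> 0)
    (fun k => - beta k)) => //.
  + by move/algebraic_inv; rewrite invrK.
  + move=> k; rewrite rmorph0 mul0r add0r (derivationV (derD k) (derM k)) dt1.
    by rewrite rmorphN exprVn.
  + by move=> k l; rewrite !(derivation0 (derD _)).
  + apply: (frac _ t) => //; exists 1, 'X; rewrite map_polyX rmorph1 hornerX.
    by rewrite hornerC fmorph_eq0 invr_neq0 // fmorphV t1E div1r invrK.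
- apply: descends_algebraic => //; split=> // x.
  apply: (@algebraicOver_sub _ _ _ i e1).
  have [q q0 qx] := finite_algebraic eA (proj1 Bdiff) fin
    ((e1B (e1 x)).2 (ex_intro _ x erefl)).
  by exists q => //; rewrite (eq_map_poly (g := e)).
Qed.

Lemma tower_descends : dmorph iota ->
  liouvillian_tower (@der n L) (range iota) ->
  has_affine_forms V iota ->
  exists (E0 : dfield n) (h0 : {rmorphism K -> E0}),
    dalg h0 /\ has_affine_forms V h0.
Proof.
move=> di [m [F [F0 Fm Fdiff Fstep]]] good.
have : forall l, (l <= m)%N -> subfield_descends (F l).
  elim=> [|l IH] lm; first by rewrite F0; apply: range_descends.
  have [sub step] := Fstep l lm; apply: step_descends step (IH (ltnW lm)) => //.
  exact: Fdiff.
move/(_ m (leqnn m)); rewrite Fm => -[N [e [c [de eT ec desc]]]].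
(* The top stage is all of [L], so [e] is onto and [L] is an algebraic extension of [N]. *)
apply: (desc L e).
  split=> // y; have [x <-] := (eT y).1 Logic.I; exact: algebraic_id.
have [w [a wa]] := good; exists w, a.
rewrite (_ : (fun _ _ => _) = fun s k => iota (V s k)) //.
by apply/funext => s; apply/funext => k; apply: ec.
Qed.

End Tower.

(** * From the first integral to forms over a finite extension of the rational function field *)

Lemma ratfun_pchar0 (R : realType) n : [pchar ratfun R n] =i pred0.
Proof.
pose h : {rmorphism R[i] -> ratfun R n} :=
  (@tofrac {mpoly R[i][n]}) \o (@mpolyC n R[i]).
exact: (pchar0_rmorph h (@Num.Theory.pchar_num _)).
Qed.

Theorem theorem3 (R : realType) (n : nat) (hn : (3 <= n)%N)
    (P : 'I_n -> ratfun R n) :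
  has_liouvillian_first_integral (@pderiv R n) (codim1_form P) ->
  exists (Kt : fieldExtType (ratfun R n)) (D : 'I_n -> Kt -> Kt),
    differential_extension (@pderiv R n) D (in_alg Kt) /\
    exists omega alpha : dform n Kt,
      [/\ homogeneous 1 omega, homogeneous 1 alpha & omega != 0] /\
      [/\ wedge omega (map_form (in_alg Kt) (codim1_form P)) = 0,
          extd D omega = wedge alpha omega
        & extd D alpha = 0].
Proof.
move=> [L0 [DL [iota [[[DLP iotaD] _ tower] [phi [phi_nc phi_int]]]]]].
pose K := DField (@ratfun_pchar0 R n) (@pderiv_commuting R n).
pose L := DField (pchar0_rmorph iota (@ratfun_pchar0 R n)) DLP.
(* Row [S] of [V] is the equation that the coefficient of omega /\ Omega at [S] vanishes. *)
pose V (S : {set 'I_n}) (k : 'I_n) : K := contraction_coef (codim1_form P) S k.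
have [|E [h [algh [w [a waP]]]]] := @tower_descends n K _ V L iota iotaD tower.
  (* The starting pair is (d phi, 0): d phi is non-zero as [phi] is not constant, and closed as the
     derivations commute. *)
  exists (fun k => DL k phi), (fun=> 0); split.
  - apply: contrapT => nz; apply: phi_nc => k; apply/eqP/negPn/negP => dk.
    by apply: nz; exists k.
  - move=> S.
    have : wedge (extd DL (form0 n phi)) (map_form iota (codim1_form P)) S = 0.
      by rewrite phi_int ffunE.
    rewrite wedge_oneformE; last exact: (extd_form0_homogeneous (@derD _ L)).
    move=> e; rewrite -[RHS]e; apply: eq_bigr => k _.
    by rewrite extd_form0 contraction_coef_map.
  - by move=> k l; rewrite (derC (A := L)) !mul0r !subrr.
  - by move=> k l; rewrite !(derivation0 (@derD _ L _)).
(* [E] is algebraic over [K] but perhaps infinite; the coefficients of the forms lie in a simple,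
   hence finite, extension [S]. *)
have [z zP] := finitely_generated_simple
  ([seq w k | k : 'I_n] ++ [seq a k | k : 'I_n]) (@dpchar0 _ K) algh.2.
have [p [S [D [s [_ [DP DE] [sD sh] [_ gen] _]]]]] :=
  simple_subextension z algh.
have /boolp.choice[w1 w1E] : forall k, exists x, s x = w k.
  move=> k; have [|q ->] := zP (w k); last exact: gen.
  by rewrite mem_cat fintype.image_f.
have /boolp.choice[a1 a1E] : forall k, exists x, s x = a k.
  move=> k; have [|q ->] := zP (a k); last exact: gen.
  by rewrite mem_cat orbC fintype.image_f.
have [w1_neq0 w1V dw1 da1] :
    affine_forms D (fun t k => in_alg S (V t k)) w1 a1.
  apply/(affine_forms_transfer _ _ _ sD).
  rewrite (_ : s \o w1 = w); last by apply/funext => k; apply: w1E.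
  rewrite (_ : s \o a1 = a); last by apply/funext => k; apply: a1E.
  rewrite (_ : (fun _ _ => _) = fun t k => h (V t k)) //.
  by apply/funext => t; apply/funext => k; apply: sh.
have DD : forall k x y, D k (x + y) = D k x + D k y by case: DP.
exists S, D; split; first by split.
exists (oneform w1), (oneform a1); split; split.
- exact: oneform_homogeneous.
- exact: oneform_homogeneous.
- have [k wk] := w1_neq0; apply: contraNneq wk => w0.
  by rewrite -(oneform1 w1 k) w0 ffunE.
- apply/ffunP => T; rewrite wedge_oneformE; last exact: oneform_homogeneous.
  rewrite ffunE -[RHS](w1V T); apply: eq_bigr => k _.
  by rewrite oneform1 contraction_coef_map.
- exact: extd_oneform_wedge.
- exact: extd_oneform_eq0.
Qed.
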